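(* Consider the stochastic variational inequality problem SVI$(X,F)$ with $F$ continuous and solution set $X^*\neq\emptyset$. Suppose that: (A1) for all $k\ge 0$, almost surely $\mathbb{E}[w_k\mid\mathcal F_k]=0$ and $\mathbb{E}[w_{k+1/2}\mid\mathcal F_{k+1/2}]=0$; (A2) there exists $\nu>0$ such that for all $k\ge 0$, almost surely $\mathbb{E}[\|w_k\|^2\mid\mathcal F_k]\le\nu^2$ and $\mathbb{E}[\|w_{k+1/2}\|^2\mid\mathcal F_{k+1/2}]\le\nu^2$; (A3) $\sum_{k=0}^\infty\gamma_k^2<\infty$; (A4) $\sum_{k=0}^\infty\gamma_k=\infty$; (A6) there exist $L_*,B_*>0$ such that $\|F(x)-F(y)\|_*\le L_*\|x-y\|$ and $\|F(x)\|_*\le B_*/2$ for all $x,y\in X$; (A7) there exists $\nu_*>0$ such that for all $k\ge0$, $\mathbb{E}[\|w_k\|_*^2\mid\mathcal F_k]\le\nu_*^2$ and $\mathbb{E}[\|w_{k+1/2}\|_*^2\mid\mathcal F_{k+1/2}]\le\nu_*^2$. Let $\{x_k\}$ be a sequence of iterates generated by the mirror-prox scheme (MPSA), where $\gamma_0$ is chosen to be sufficiently small (i.e. $\gamma_0\le\bar\gamma$ for a suitable threshold $\bar\gamma>0$). Suppose one of the following statements holds: (i) $F$ satisfies the acute angle relation at $X^*$: $(x-x^* )^TF(x)>0$ for any $x\in X\setminus X^*$ and $x^*\in X^*$; (ii) $F$ is strictly pseudomonotone on $X$; (iii) $F$ is strongly pseudomonotone on $X$; (iv) $F$ is pseudomonotone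 on $X$ and is given by the gradient of $\mathbb{E}[f(x,\omega)]$. Then, almost surely, $\{x_k\}$ is bounded and any limit point of $\{x_k\}$ is a solution of SVI$(X,F)$.
   Context: Let $X\subseteq\mathbb{R}^n$ be nonempty, closed and convex, $\xi:\Omega\to\mathbb{R}^d$ a random vector on a probability space, $F(x;\omega):=F(x,\xi(\omega))\in\mathbb{R}^n$ and $F(x):=\mathbb{E}[F(x;\omega)]$ (componentwise). SVI$(X,F)$ is the problem of finding $x^*\in X$ with $(x-x^* )^TF(x^* )\ge 0$ for all $x\in X$; its solution set is $X^*$. $\|\cdot\|$ is a norm on $\mathbb{R}^n$, with dual norm $\|x\|_*:=\sup\{z^Tx:\|z\|\le1\}$. Prox function: $s$ is a strongly convex differentiable function and $V(x,z):=s(z)-[s(x)+\nabla s(x)^T(z-x)]$. There is a scalar $\theta\ge1$ with $V(x,z)\ge\frac{\theta}{2}\|x-z\|^2$. It is assumed that $\nabla s$ is Lipschitz continuous with a positive constant $L_V$, with $V(x,z)\le L_V^2\|x-z\|^2$. Define $\mathbf P_X(x,r):=\arg\min_{z\in X}\big(r^Tz+V(x,z)\big)$. Mirror-prox stochastic approximation scheme (MPSA): given $x_0\in X$ and a positive diminishing steplength sequence $\{\gamma_k\}$, for $k\ge0$, $$x_{k+1/2}:=\mathbf P_X(x_k,\gamma_kF(x_k;\omega_k)),\qquad x_{k+1}:=\mathbf P_X(x_k,\gamma_kF(x_{k+1/2};\omega_{k+1/2})),$$ where $\omega_k,\omega_{k+1/2}$ are the samples drawn at iteration $k$, $w_k:=F(x_k;\omega_k)-F(x_k)$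 and $w_{k+1/2}:=F(x_{k+1/2};\omega_{k+1/2})-F(x_{k+1/2})$. The histories are $\mathcal F_k:=\sigma\{x_0,\omega_0,\omega_{1/2},\omega_1,\dots,\omega_{k-1/2}\}$ and $\mathcal F_{k+1/2}:=\sigma(\mathcal F_k\cup\{\omega_k\})$. A continuous map $F$ is: pseudomonotone on $X$ if for all $x,y\in X$, $(x-y)^TF(y)\ge0\Rightarrow(x-y)^TF(x)\ge0$; strictly pseudomonotone on $X$ if for all $x\ne y$ in $X$, $(x-y)^TF(y)\ge0\Rightarrow(x-y)^TF(x)>0$; strongly pseudomonotone on $X$ if there exists $\sigma>0$ such that for all $x\neq y$ in $X$, $(x-y)^TF(y)\ge0\Rightarrow(x-y)^TF(x)\ge\sigma\|x-y\|^2$. *)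

(* Defs.v *)
From HB Require Import structures.
From mathcomp Require Export all_boot all_order all_algebra.
From mathcomp Require Export all_classical all_reals all_analysis.
Export Order.TTheory GRing.Theory Num.Theory.
Export numFieldNormedType.Exports.

Set Implicit Arguments.
Unset Strict Implicit.
Unset Printing Implicit Defensive.

Local Open Scope classical_set_scope.
Local Open Scope ring_scope.

(* Row vectors already carry a canonical (sup) norm, written `| |; it only
   provides the topology of R^n here.  The norm of the problem is an arbitrary
   function [nrm] satisfying [is_norm]. *)

Section Vectors.
Context {R : realType} {n : nat}.
Implicit Types (nrm : 'rV[R]_n -> R) (X : set 'rV[R]_n).

Definition dot (u v : 'rV[R]_n) : R := \sum_(i < n) u 0 i * v 0 i.

Definition is_norm nrm : Prop :=
  [/\ forall x y, nrm (x + y) <= nrm x + nrm y,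
      forall a x, nrm (a *: x) = `|a| * nrm x
    & forall x, nrm x = 0 -> x = 0].

Definition dual_norm nrm (x : 'rV[R]_n) : R :=
  sup [set dot z x | z in [set z | nrm z <= 1]].

Definition grad (s : 'rV[R]_n -> R) (x : 'rV[R]_n) : 'rV[R]_n :=
  \row_i 'd s x (delta_mx 0 i).

Definition strongly_convex_on nrm X (s : 'rV[R]_n -> R) : Prop :=
  exists2 mu : R, 0 < mu &
    forall x y t, X x -> X y -> 0 <= t <= 1 ->
      s (t *: x + (1 - t) *: y) <=
        t * s x + (1 - t) * s y - mu / 2 * t * (1 - t) * nrm (x - y) ^+ 2.

Definition bregman (s : 'rV[R]_n -> R) (x z : 'rV[R]_n) : R :=
  s z - (s x + dot (grad s x) (z - x)).

(* Everything is only asked on X, the domain on which the scheme evaluates the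
   prox function.  As a gradient is a dual vector, its variation is measured in
   the dual norm. *)
Definition prox_function nrm X (s : 'rV[R]_n -> R) (theta LV : R) : Prop :=
  [/\ strongly_convex_on nrm X s,
      forall x, X x -> differentiable s x,
      1 <= theta /\ forall x z, X x -> X z ->
        theta / 2 * nrm (x - z) ^+ 2 <= bregman s x z,
      0 < LV /\ forall x y, X x -> X y ->
        dual_norm nrm (grad s x - grad s y) <= LV * nrm (x - y)
    & forall x z, X x -> X z -> bregman s x z <= LV ^+ 2 * nrm (x - z) ^+ 2].

Definition argmin X (phi : 'rV[R]_n -> R) : set 'rV[R]_n :=
  [set z | X z /\ forall y, X y -> phi z <= phi y].

Definition prox X (s : 'rV[R]_n -> R) (x r : 'rV[R]_n) : set 'rV[R]_n :=
  argmin X (fun z => dot r z + bregman s x z).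

End Vectors.

Section VariationalInequality.
Context {R : realType} {n : nat}.
Implicit Types (X : set 'rV[R]_n) (F : 'rV[R]_n -> 'rV[R]_n).

Definition SVI X F : set 'rV[R]_n :=
  [set xs | X xs /\ forall x, X x -> 0 <= dot (x - xs) (F xs)].

Definition acute_angle X F : Prop :=
  forall x xs, (X `\` SVI X F) x -> SVI X F xs -> 0 < dot (x - xs) (F x).

Definition pseudomonotone X F : Prop :=
  forall x y, X x -> X y ->
    0 <= dot (x - y) (F y) -> 0 <= dot (x - y) (F x).

Definition strictly_pseudomonotone X F : Prop :=
  forall x y, X x -> X y -> x <> y ->
    0 <= dot (x - y) (F y) -> 0 < dot (x - y) (F x).

Definition strongly_pseudomonotone (nrm : 'rV[R]_n -> R) X F : Prop :=
  exists2 sigma : R, 0 < sigma &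
    forall x y, X x -> X y -> x <> y ->
      0 <= dot (x - y) (F y) -> sigma * nrm (x - y) ^+ 2 <= dot (x - y) (F x).

End VariationalInequality.

Definition borel_rV (R : realType) (n : nat) :=
  g_sigma_algebraType (@open 'rV[R]_n).

Section Stochastic.
Context {R : realType} {n m : nat} {d : measure_display} {Om : measurableType d}.
Implicit Types (P : probability Om R) (xi : Om -> borel_rV R m).
Implicit Types (F : 'rV[R]_n -> 'rV[R]_m -> 'rV[R]_n).

Definition mean_map P xi F (x : 'rV[R]_n) : 'rV[R]_n :=
  \row_i fine 'E_P[fun w => F x (xi w) 0 i].

(* F is a jointly measurable integrand whose expectation exists on X. *)
Definition random_map P xi (X : set 'rV[R]_n) F : Prop :=
  measurable_fun (X `*` [set: borel_rV R m] : set (borel_rV R n * borel_rV R m))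
    (fun p => F p.1 p.2 : borel_rV R n) /\
  forall x, X x -> forall i,
    P.-integrable [set: Om] (fun w => (F x (xi w) 0 i)%:E).

(* F is, on X, the gradient of x |-> E[f(x, w)]; the integrability near each
   point of X makes this expectation meaningful where it is differentiated. *)
Definition expected_gradient P (X : set 'rV[R]_n) (F : 'rV[R]_n -> 'rV[R]_n)
  : Prop :=
  exists f : 'rV[R]_n -> Om -> R,
    let phi := fun x => fine 'E_P[f x] in
    forall x, X x ->
      [/\ \forall y \near x, P.-integrable [set: Om] (fun w => (f y w)%:E),
          differentiable phi x
        & grad phi x = F x].

End Stochastic.

Section ConditionalExpectation.
Context {R : realType} {d : measure_display} {S : measurableType d}.
Implicit Types (Q : probability S R) (G : set_system S) (f g : S -> R).

Definition is_condexp Q G f g : Prop :=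
  [/\ Q.-integrable [set: S] (EFin \o f),
      Q.-integrable [set: S] (EFin \o g),
      forall B : set R, measurable B -> G (g @^-1` B)
    & forall A, G A ->
        (\int[Q]_(t in A) (f t)%:E = \int[Q]_(t in A) (g t)%:E)%E].

(* The conditional expectation E[f | G] exists and, almost surely, satisfies
   [prop]; versions agree almost surely, so the choice of g is immaterial. *)
Definition condexp_as Q G f (prop : R -> Prop) : Prop :=
  exists2 g, is_condexp Q G f g & {ae Q, forall t, prop (g t)}.

End ConditionalExpectation.

Section MirrorProx.
Context {R : realType} {n m : nat}.
Context {dO dS : measure_display} {Om : measurableType dO}
  {S : measurableType dS}.
(* S is the sample space on which the draws are defined: [om k] and [omh k]
   are the random elements omega_k and omega_{k+1/2} of Om, and [x k], [xh k]
   the iterates x_k and x_{k+1/2}. *)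
Implicit Types (om omh : nat -> S -> Om) (x xh : nat -> S -> 'rV[R]_n).

Definition noise (P : probability Om R) (xi : Om -> borel_rV R m)
    (F : 'rV[R]_n -> 'rV[R]_m -> 'rV[R]_n)
    (y : S -> 'rV[R]_n) (o : S -> Om) (t : S) : 'rV[R]_n :=
  F (y t) (xi (o t)) - mean_map P xi F (y t).

Definition mpsa (X : set 'rV[R]_n) (s : 'rV[R]_n -> R)
    (xi : Om -> borel_rV R m) (F : 'rV[R]_n -> 'rV[R]_m -> 'rV[R]_n)
    (gamma : nat -> R) om omh x xh : Prop :=
  (forall t, X (x 0%N t)) /\
  forall k t,
    prox X s (x k t) (gamma k *: F (x k t) (xi (om k t))) (xh k t) /\
    prox X s (x k t) (gamma k *: F (xh k t) (xi (omh k t))) (x k.+1 t).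

Definition history (x0 : S -> borel_rV R n) om omh (k : nat) : set_system S :=
  <<s g_sigma_algebra_preimage x0 `|`
      \bigcup_(j in `I_k) (g_sigma_algebra_preimage (om j) `|`
                           g_sigma_algebra_preimage (omh j)) >>.

Definition history_half (x0 : S -> borel_rV R n) om omh (k : nat)
  : set_system S :=
  <<s history x0 om omh k `|` g_sigma_algebra_preimage (om k) >>.

End MirrorProx.

(* Main.v *)
Require Import Defs.
From mathcomp Require Import measurable_realfun ring lra.

Set Implicit Arguments.
Unset Strict Implicit.
Unset Printing Implicit Defensive.

Local Open Scope classical_set_scope.
Local Open Scope ring_scope.

(** Write V for the Bregman distance of the prox function, H for the mean map,
w_k and w_(k+1/2) for the two noises. The three-point inequality of the prox
map, applied to both half-steps, gives for every y in X
  V(x_(k+1), y) + V(x_k, x_(k+1/2)) <= V(x_k, y)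
    - gamma_k (x_(k+1/2) - y).H(x_(k+1/2)) - gamma_k w_(k+1/2).(x_(k+1/2) - y)
    + r_k
with r_k at most gamma_k^2 times the squared dual norm of the difference between
the two sampled values of the map [mirror_prox_step]. As H is bounded on X and
the noises have bounded second moments, the r_k are almost surely summable
[ae_cvg_weighted_series].

Each of the four structural hypotheses reduces to the acute angle relation: for
a pseudomonotone gradient, a point x at which (x - xs).H(x) vanishes has the
same potential as the solution xs along the whole segment joining them, hence
minimizes the potential [pseudomonotone_gradient_acute]. By continuity of H the
relation makes (x - xs).H(x) nonnegative on all of X [acute_angle_ge0], so for a
solution y the second term on the right-hand side above has the good sign.

The noise term is a martingale difference whose coefficient x_(k+1/2) - y is
not known to be bounded or square integrable. It is therefore divided by the
running maximum rho_k of 1 and of the distances from x_(j+1/2), j <= k, to a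
fixed solution xs. The normalized series, as well as the series of the
gamma_k w_(k+1/2), are transforms of square-integrable martingale differences
by bounded predictable coefficients, hence converge almost surely
[martingale_series_cvg]; this follows from a maximal inequality proved by
stopping the martingale. Everything else is deterministic along a path on which
these series converge [path_convergence]. Since rho is nondecreasing, summation
by parts bounds the unnormalized noise sums by a multiple of rho_k, and the
one-step estimate yields rho_k^2 <= C + C' rho_k; so rho is bounded, and by
Abel's test the unnormalized noise series converges. Its dependence on y is
through the convergent series of the gamma_k w_(k+1/2), so it converges for all
solutions y at once, outside a single null set. The pathwise Robbins-Siegmund
lemma then shows that V(x_k, y) converges for each solution y, that
V(x_k, x_(k+1/2)) tends to 0, and that (x_(k+1/2) - xs).H(x_(k+1/2)) is small
infinitely often because the steplengths are not summable. A cluster point p of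
the corresponding half-iterates satisfies (p - xs).H(p) <= 0, so it is a
solution by the acute angle relation; V(x_k, p) converges and is small
infinitely often, so x_k tends to p.

Measurability of the iterates with respect to the histories comes from the fact
that the prox map is Lipschitz continuous in the vector r - grad s(x)
[prox_lipschitz], [measurable_lipschitz]. *)

(** * Dot product, arbitrary norms and their dual norms *)

Section DotProduct.
Context {R : realType} {n : nat}.
Implicit Types x y z u v : 'rV[R]_n.

Lemma dotC u v : dot u v = dot v u.
Proof. by apply: eq_bigr => i _; rewrite mulrC. Qed.

Lemma dotDl u v x : dot (u + v) x = dot u x + dot v x.
Proof. by rewrite -big_split; apply: eq_bigr => i _; rewrite mxE mulrDl. Qed.

Lemma dotZl a u x : dot (a *: u) x = a * dot u x.
Proof. by rewrite mulr_sumr; apply: eq_bigr => i _; rewrite mxE mulrA. Qed.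

Lemma dotNl u x : dot (- u) x = - dot u x.
Proof. by rewrite -scaleN1r dotZl mulN1r. Qed.

Lemma dotBl u v x : dot (u - v) x = dot u x - dot v x.
Proof. by rewrite dotDl dotNl. Qed.

Lemma dotDr x u v : dot x (u + v) = dot x u + dot x v.
Proof. by rewrite !(dotC x) dotDl. Qed.

Lemma dotZr a x u : dot x (a *: u) = a * dot x u.
Proof. by rewrite !(dotC x) dotZl. Qed.

Lemma dotNr x u : dot x (- u) = - dot x u.
Proof. by rewrite !(dotC x) dotNl. Qed.

Lemma dotBr x u v : dot x (u - v) = dot x u - dot x v.
Proof. by rewrite dotDr dotNr. Qed.

Lemma dot0l x : dot 0 x = 0.
Proof. by rewrite -(scale0r 0) dotZl mul0r. Qed.

Lemma dot_delta i x : dot (delta_mx 0 i) x = x 0 i.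
Proof.
rewrite /dot (bigD1 i)//= mxE !eqxx mul1r big1 ?addr0// => j ji.
by rewrite mxE (negbTE ji) andbF mul0r.
Qed.

Lemma ler_coord_norm x i : `|x 0 i| <= `|x|.
Proof.
rewrite [leRHS]/Num.norm /= mx_normrE.
by apply/bigmax_geP; right => /=; exists (0, i).
Qed.

Lemma norm_le_coord x e : 0 <= e -> (forall i, `|x 0 i| <= e) -> `|x| <= e.
Proof.
move=> e0 xe; rewrite [leLHS]/Num.norm /= mx_normrE.
by apply/bigmax_leP; split=> // -[a i] _ /=; rewrite (ord1 a).
Qed.

Lemma norm_lt_coord x e : 0 < e -> (forall i, `|x 0 i| < e) -> `|x| < e.
Proof.
move=> e0 xe; rewrite [ltLHS]/Num.norm /= mx_normrE.
by apply/bigmax_ltP; split=> // -[a i] _ /=; rewrite (ord1 a).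
Qed.

Lemma ler_norm_dot u v : `|dot u v| <= n%:R * `|u| * `|v|.
Proof.
rewrite (le_trans (ler_norm_sum _ _ _))//.
rewrite (@le_trans _ _ (\sum_(i < n) `|u| * `|v|))//; last first.
  by rewrite sumr_const card_ord -[leLHS]mulr_natl mulrA.
apply: ler_sum => i _; rewrite normrM ler_pM//; exact: ler_coord_norm.
Qed.

Lemma rV_sum_delta x : x = \sum_(i < n) x 0 i *: delta_mx 0 i.
Proof. exact: row_sum_delta. Qed.

Lemma lipschitz_continuous_rV (phi : 'rV[R]_n -> R) (C : R) : 0 < C ->
  (forall x y, `|phi x - phi y| <= C * `|x - y|) -> continuous phi.
Proof.
move=> C0 hphi x; apply/(@cvgrPdist_lt _ _ _ (nbhs x) (nbhs_filter x)) => e e0.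
have eC : 0 < e / C by rewrite divr_gt0.
apply: filterS (nbhsx_ballx x (e / C) eC) => y.
rewrite -ball_normE /= ltr_pdivlMr// mulrC; apply: le_lt_trans.
exact: hphi.
Qed.

End DotProduct.

Section Norms.
Context {R : realType} {n : nat}.
Variable nrm : 'rV[R]_n -> R.
Hypothesis nrmP : is_norm nrm.
Implicit Types x y z u v : 'rV[R]_n.

Lemma nrm_triangle x y : nrm (x + y) <= nrm x + nrm y.
Proof. by case: nrmP. Qed.

Lemma nrmZ a x : nrm (a *: x) = `|a| * nrm x.
Proof. by case: nrmP. Qed.

Lemma nrm0 : nrm 0 = 0.
Proof. by rewrite -(scale0r 0) nrmZ normr0 mul0r. Qed.

Lemma nrmN x : nrm (- x) = nrm x.
Proof. by rewrite -scaleN1r nrmZ normrN1 mul1r. Qed.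

Lemma nrm_sub x y : nrm (x - y) = nrm (y - x).
Proof. by rewrite -nrmN opprB. Qed.

Lemma nrm_ge0 x : 0 <= nrm x.
Proof.
have := nrm_triangle x (- x); rewrite subrr nrm0 nrmN => h.
by rewrite -(pmulrn_lge0 _ (ltn0Sn 1)) mulr2n.
Qed.

(** [nrm_le_sup] and [sup_le_nrm]: any norm is equivalent to the sup norm. *)
Lemma nrm_le_sup : exists2 C, 0 < C & forall x, nrm x <= C * `|x|.
Proof.
exists (1 + \sum_(i < n) nrm (delta_mx 0 i)).
  by rewrite ltr_wpDr// sumr_ge0// => i _; exact: nrm_ge0.
move=> x; rewrite {1}(rV_sum_delta x).
apply: (@le_trans _ _ (\sum_(i < n) `|x| * nrm (delta_mx 0 i))); last first.
  by rewrite -mulr_sumr mulrC ler_wpM2r// lerDr.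
elim/big_ind2: _; first by rewrite nrm0.
- by move=> a b c d ab cd; rewrite (le_trans (nrm_triangle _ _))// lerD.
- move=> i _; rewrite nrmZ ler_wpM2r ?nrm_ge0//; exact: ler_coord_norm.
Qed.

Lemma nrm_continuous : continuous nrm.
Proof.
have [C C0 nC] := nrm_le_sup; apply: (lipschitz_continuous_rV C0) => x y.
apply: le_trans (nC _); rewrite ler_norml; apply/andP; split.
  rewrite lerBrDl lerBlDr addrC.
  by have := nrm_triangle (y - x) x; rewrite subrK nrm_sub addrC.
by rewrite lerBlDr; have := nrm_triangle (x - y) y; rewrite subrK.
Qed.

Lemma sup_le_nrm : exists2 c, 0 < c & forall x, `|x| <= c * nrm x.
Proof.
pose A : set 'rV[R]_n := [set x | `|x| = 1].
(* The unit sphere is empty in dimension 0. *)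
have [A0|/set0P[a Aa]] := eqVneq A set0.
  exists 1 => // x; rewrite mul1r.
  have [->|x0] := eqVneq x 0; first by rewrite normr0 nrm_ge0.
  suff : A (`|x|^-1 *: x) by rewrite A0.
  by rewrite /A /= normrZ normrV ?unitfE ?normr_eq0// normr_id mulVf ?normr_eq0.
have cA : compact A.
  apply: bounded_closed_compact.
    by exists 1; split=> // M M1 x /= ->; exact: ltW.
  apply: (@closed_comp _ _ (fun x : 'rV[R]_n => `|x|) [set 1]).
    by move=> x _; exact: norm_continuous.
  exact: closed_eq.
(* The smallest value of the norm on the unit sphere of the sup norm is
   positive, and its inverse is the constant. *)
have [||c Ac cmin] := @EVT_min_rV R n nrm A _ cA.
- by exists a.
- by apply: continuous_subspaceT; exact: nrm_continuous.
have c0 : 0 < nrm c.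
  rewrite lt_neqAle nrm_ge0 andbT eq_sym; apply/eqP => c0.
  case: nrmP => _ _ /(_ _ c0) c00; move: Ac; rewrite inE /A /= c00 normr0 => /esym/eqP.
  by rewrite oner_eq0.
exists (nrm c)^-1; first by rewrite invr_gt0.
move=> x; rewrite mulrC ler_pdivlMr//.
have [->|x0] := eqVneq x 0; first by rewrite normr0 mul0r nrm_ge0.
have nx0 : 0 < `|x| by rewrite normr_gt0.
have /cmin : (`|x|^-1 *: x) \in A.
  by rewrite inE /A /= normrZ normrV ?unitfE ?normr_eq0// normr_id mulVf ?normr_eq0.
by rewrite nrmZ gtr0_norm ?invr_gt0// mulrC ler_pdivlMr// mulrC.
Qed.

(** The supremum defining the dual norm is that of a nonempty bounded set. *)
Lemma dual_norm_has_sup x :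
  has_sup [set dot z x | z in [set z | nrm z <= 1]].
Proof.
have [c c0 hc] := sup_le_nrm.
split; first by exists (dot 0 x), 0 => //=; rewrite nrm0.
exists (n%:R * c * `|x|) => _ [z /= z1 <-].
rewrite (le_trans (ler_norm _))// (le_trans (ler_norm_dot _ _))//.
rewrite ler_wpM2r// ler_wpM2l// (le_trans (hc z))//.
by rewrite -[leRHS]mulr1 ler_pM2l.
Qed.

Lemma dual_norm_ge0 x : 0 <= dual_norm nrm x.
Proof.
have /sup_upper_bound := dual_norm_has_sup x; apply.
by exists 0 => /=; [rewrite nrm0|rewrite dot0l].
Qed.

Lemma dot_le_dual z x : dot z x <= nrm z * dual_norm nrm x.
Proof.
have [z0|z0] := eqVneq (nrm z) 0.
  by case: nrmP => _ _ /(_ _ z0) ->; rewrite dot0l nrm0 mul0r.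
have pz : 0 < nrm z by rewrite lt_neqAle eq_sym z0 nrm_ge0.
rewrite -ler_pdivrMl// -dotZl.
have /sup_upper_bound := dual_norm_has_sup x; apply.
exists ((nrm z)^-1 *: z) => //=.
by rewrite nrmZ gtr0_norm ?invr_gt0// mulVf.
Qed.

Lemma abs_dot_le_dual z x : `|dot z x| <= nrm z * dual_norm nrm x.
Proof.
rewrite ler_norml dot_le_dual andbT lerNl -dotNl -(nrmN z).
exact: dot_le_dual.
Qed.

Lemma dual_norm_le x b :
  (forall z, nrm z <= 1 -> dot z x <= b) -> dual_norm nrm x <= b.
Proof.
move=> h; apply: ge_sup => [|_ [z /= z1 <-]]; last exact: h.
by case: (dual_norm_has_sup x).
Qed.

Lemma dual_norm_triangle x y :
  dual_norm nrm (x + y) <= dual_norm nrm x + dual_norm nrm y.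
Proof.
apply: dual_norm_le => z z1; rewrite dotDr.
apply: lerD; rewrite (le_trans (dot_le_dual _ _))//
  -[leRHS]mul1r ler_wpM2r ?dual_norm_ge0//.
Qed.

Lemma dual_normN x : dual_norm nrm (- x) = dual_norm nrm x.
Proof.
by apply/eqP; rewrite eq_le; apply/andP; split; apply: dual_norm_le => z z1;
  rewrite -[leRHS]mul1r;
  [rewrite dotNr -dotNl | rewrite -[dot _ _]opprK -dotNl -dotNr];
  rewrite (le_trans (dot_le_dual _ _))// ler_wpM2r ?dual_norm_ge0// nrmN.
Qed.

Lemma dual_le_sup : exists2 C, 0 < C & forall x, dual_norm nrm x <= C * `|x|.
Proof.
have [c c0 hc] := sup_le_nrm.
exists (1 + n%:R * c); first by rewrite ltr_wpDr// mulr_ge0// ltW.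
move=> x; apply: dual_norm_le => z z1.
rewrite (le_trans (ler_norm _))// (le_trans (ler_norm_dot _ _))//.
rewrite ler_wpM2r// (@le_trans _ _ (n%:R * c)) ?lerDr//.
rewrite ler_wpM2l// (le_trans (hc z))//.
by rewrite -[leRHS]mulr1 ler_pM2l.
Qed.

Lemma sup_le_dual : exists2 c, 0 < c & forall x, `|x| <= c * dual_norm nrm x.
Proof.
pose c := 1 + \sum_(i < n) nrm (delta_mx 0 i).
have sg0 : 0 <= \sum_(i < n) nrm (delta_mx 0 i).
  by rewrite sumr_ge0// => i _; exact: nrm_ge0.
have c0 : 0 < c by rewrite ltr_wpDr.
exists c => // x; apply: norm_le_coord.
  by rewrite mulr_ge0 ?dual_norm_ge0// ltW.
move=> i; rewrite -dot_delta (le_trans (abs_dot_le_dual _ _))//.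
rewrite ler_wpM2r ?dual_norm_ge0// /c (bigD1 i)//= addrCA lerDl addr_ge0//.
by rewrite sumr_ge0// => j _; exact: nrm_ge0.
Qed.

End Norms.

(** * First-order optimality and the prox map *)

Lemma convex_setP (R : realType) n (X : set 'rV[R]_n) x y (t : R) :
  convex_set (M := 'rV[R]_n) X -> X x -> X y -> 0 <= t <= 1 ->
  X (x + t *: (y - x)).
Proof.
move=> cX Xx Xy /andP[t0 t1].
have := cX y x (Itv01 t0 t1); rewrite !inE => /(_ Xy Xx).
by rewrite /conv/= /unstable.onem scalerBl scale1r scalerBr addrCA.
Qed.

Section Differential.
Context {R : realType} {n : nat}.
Implicit Types (s : 'rV[R]_n -> R) (x y z v q : 'rV[R]_n).

Lemma diff_dot_grad s x v : differentiable s x -> 'd s x v = dot v (grad s x).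
Proof.
move=> ds; rewrite {1}(rV_sum_delta v) linear_sum /=.
by apply: eq_bigr => i _; rewrite linearZ /= mxE.
Qed.

Lemma derive_line s x v : differentiable s x ->
  (fun h => h^-1 *: (s (h *: v + x) - s x)) @ 0^' --> dot v (grad s x).
Proof.
move=> ds; rewrite -diff_dot_grad// -deriveE//.
exact: diff_derivable.
Qed.

(** First-order optimality condition on a convex set. *)
Lemma first_order_min (X : set 'rV[R]_n) s q z :
  convex_set (M := 'rV[R]_n) X -> X z -> differentiable s z ->
  (forall y, X y -> s z <= s y + dot q (y - z)) ->
  forall y, X y -> 0 <= dot (grad s z + q) (y - z).
Proof.
move=> cX Xz ds hmin y Xy.
(* Only one-sided difference quotients, at points of the segment from [z] to
   [y], are controlled. *)
have dl := @derive_line s z (y - z) ds.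
have {dl} dl : (fun h => h^-1 *: (s (h *: (y - z) + z) - s z)) @ 0^'+
     --> dot (y - z) (grad s z).
  apply: cvg_trans dl; apply: cvg_app.
  by apply: within_subset => h /=; exact: lt0r_neq0.
rewrite dotDl -lerBlDr sub0r [leRHS]dotC.
apply: (cvgr_to_ge dl); near=> h.
have h0 : 0 < h by near: h; exact: nbhs_right_gt.
have h1 : h <= 1 by near: h; exact: nbhs_right_le.
have Xh : X (z + h *: (y - z)).
  by apply: convex_setP => //; rewrite (ltW h0).
rewrite -ler_pdivrMl ?invr_gt0// invrK.
have := hmin _ Xh; rewrite [z + _ - z]addrC addKr dotZr (addrC z) /GRing.scale /=.
by rewrite mulrN lerBrDr -subr_ge0 => ?; lra.
Unshelve. all: end_near. Qed.
End Differential.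

Section Prox.
Context {R : realType} {n : nat}.
Variables (nrm : 'rV[R]_n -> R) (X : set 'rV[R]_n).
Variables (s : 'rV[R]_n -> R) (theta LV : R).
Hypotheses (nrmP : is_norm nrm) (cX : convex_set (M := 'rV[R]_n) X).
Hypothesis sP : prox_function nrm X s theta LV.
Implicit Types x y z r u v : 'rV[R]_n.

Lemma bregman_lower x z : X x -> X z -> nrm (x - z) ^+ 2 <= 2 * bregman s x z.
Proof.
move=> Xx Xz; case: sP => _ _ [t1 /(_ _ _ Xx Xz) h] _ _.
have : nrm (x - z) ^+ 2 <= theta * nrm (x - z) ^+ 2.
  by rewrite ler_peMl// sqr_ge0.
lra.
Qed.

Lemma bregman_ge0 x z : X x -> X z -> 0 <= bregman s x z.
Proof.
by move=> Xx Xz; have := bregman_lower Xx Xz; have := sqr_ge0 (nrm (x - z)); lra.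
Qed.

(** The three-point identity of the Bregman distance. *)
Lemma bregman3 x y z :
  bregman s x y - bregman s x z - bregman s z y =
  dot (grad s z - grad s x) (y - z).
Proof.
rewrite /bregman; move: (grad s x) (grad s z) => gx gz.
by rewrite !dotBl !dotBr; ring.
Qed.

Lemma bregman_sym x z :
  bregman s x z + bregman s z x = dot (grad s x - grad s z) (x - z).
Proof.
rewrite /bregman; move: (grad s x) (grad s z) => gx gz.
by rewrite !dotBl !dotBr; ring.
Qed.

Lemma prox_first_order x r z : X x -> prox X s x r z ->
  forall y, X y -> 0 <= dot (grad s z + (r - grad s x)) (y - z).
Proof.
move=> Xx [Xz zmin] y Xy; case: sP => _ ds _ _ _.
apply: (first_order_min cX Xz (ds _ Xz) _ Xy) => {Xy}y Xy.
move: (zmin _ Xy); rewrite /bregman; move: (grad s x) => gx; rewrite dotBl !dotBr; lra.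
Qed.

Lemma prox_three_point x r z : X x -> prox X s x r z ->
  forall y, X y ->
  dot r (z - y) <= bregman s x y - bregman s x z - bregman s z y.
Proof.
move=> Xx zP y Xy; rewrite bregman3.
have := prox_first_order Xx zP Xy; move: (grad s x) (grad s z) => gx gz.
by rewrite dotDl !dotBl !dotBr; lra.
Qed.

(** The prox map is Lipschitz continuous with respect to the vector
[r - grad s x], on which alone it depends. *)
Lemma prox_lipschitz x r z x' r' z' : X x -> X x' ->
  prox X s x r z -> prox X s x' r' z' ->
  nrm (z - z') <= dual_norm nrm ((r - grad s x) - (r' - grad s x')).
Proof.
move=> Xx Xx' zP z'P; have [[Xz _] [Xz' _]] := (zP, z'P).
have h1 := prox_first_order Xx zP Xz'.
have h2 := prox_first_order Xx' z'P Xz.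
have h3 := bregman_sym z z'.
have h4 := bregman_lower Xz Xz'.
have h5 := bregman_lower Xz' Xz; rewrite (nrm_sub nrmP) in h5.
set p := r - grad s x in h1 *; set p' := r' - grad s x' in h2 *.
have h6 := dot_le_dual nrmP (z' - z) (p - p'); rewrite (nrm_sub nrmP) in h6.
have h7 : nrm (z - z') ^+ 2 <= nrm (z - z') * dual_norm nrm (p - p').
  apply: le_trans h6; move: h1 h2 h3; rewrite {}/p {}/p'.
  move: (r - grad s x) (r' - grad s x') (grad s z) (grad s z') => p p' gz gz'.
  rewrite !(dotDl, dotBl, dotBr, dotNl, dotNr) !(dotC _ p) !(dotC _ p') => h1 h2 h3.
  lra.
have [->|n0] := eqVneq (nrm (z - z')) 0; first exact: dual_norm_ge0.
have {}n0 : 0 < nrm (z - z') by rewrite lt_neqAle eq_sym n0 nrm_ge0.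
by move: h7; rewrite expr2 ler_pM2l.
Qed.

(** The one-step estimate of the mirror-prox scheme: [z] is the half-step from
[x] along [g] and [z'] the full step from [x] along [gh]. The three-point
inequality is used for [z'] at [y] and for [z] at [z']; the cross term
[dot (gh - g) (z - z')] is absorbed by [bregman s z z']. *)
Lemma mirror_prox_step x g gh z z' y : X x -> X y ->
  prox X s x g z -> prox X s x gh z' ->
  bregman s z' y + bregman s x z <=
    bregman s x y - dot gh (z - y) + dual_norm nrm (gh - g) ^+ 2.
Proof.
move=> Xx Xy zP z'P; have [[Xz _] [Xz' _]] := (zP, z'P).
have h1 := prox_three_point Xx z'P Xy.
have h2 := prox_three_point Xx zP Xz'.
have h3 := bregman_lower Xz Xz'.
have h4 := dot_le_dual nrmP (z - z') (gh - g).
have h5 := sqr_ge0 (nrm (z - z') - dual_norm nrm (gh - g)).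
move: h1 h2 h4; rewrite !(dotBr, dotBl, dotNl, dotNr) !(dotC _ g) !(dotC _ gh).
move: h5 h3; rewrite sqrrB.
have := sqr_ge0 (dual_norm nrm (gh - g)).
move: (nrm (z - z')) (dual_norm _ _) => N D; rewrite -mulr_natl => *; lra.
Qed.

End Prox.

(** * The acute angle relation *)

Section AcuteAngle.
Context {R : realType} {n : nat}.
Variables (X : set 'rV[R]_n) (H : 'rV[R]_n -> 'rV[R]_n).
Hypothesis cX : convex_set (M := 'rV[R]_n) X.
Implicit Types x y z v a b : 'rV[R]_n.

Lemma strictly_pseudomonotone_acute :
  strictly_pseudomonotone X H -> acute_angle X H.
Proof.
move=> sH x xs [Xx nx] sxs; have [Xxs hxs] := sxs.
by apply: (sH _ _ Xx Xxs) => [xxs|]; [apply: nx; rewrite xxs|exact: hxs].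
Qed.

Lemma strongly_pseudomonotone_strictly (nrm : 'rV[R]_n -> R) : is_norm nrm ->
  strongly_pseudomonotone nrm X H -> strictly_pseudomonotone X H.
Proof.
move=> nrmP [sg sg0 sH] x y Xx Xy xy h.
apply: lt_le_trans (sH _ _ Xx Xy xy h).
rewrite mulr_gt0// exprn_gt0// lt_neqAle (nrm_ge0 nrmP) andbT eq_sym.
apply/eqP => h0; apply: xy; case: nrmP => _ _ /(_ _ h0) /eqP.
by rewrite subr_eq0 => /eqP.
Qed.

Lemma is_derive_line (phi : 'rV[R]_n -> R) a v (t : R) :
  differentiable phi (a + t *: v) ->
  is_derive t 1 (fun u => phi (a + u *: v)) (dot v (grad phi (a + t *: v))).
Proof.
move=> dphi; have dl := derive_line (v := v) dphi.
have E : (fun h => h^-1 *: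
    (((fun u => phi (a + u *: v)) \o shift t) (h *: (1 : R)) - phi (a + t *: v)))
    = (fun h => h^-1 *: (phi (h *: v + (a + t *: v)) - phi (a + t *: v))).
  apply/funext => h /=; congr (_ *: (phi _ - _)).
  by rewrite addrCA -scalerDl /GRing.scale /= mulr1.
apply: DeriveDef; first by rewrite /derivable E; apply/cvg_ex; eexists; exact: dl.
by rewrite /derive E; apply/cvg_lim.
Qed.

Lemma le_of_segment_grad (phi : 'rV[R]_n -> R) x y :
  (forall t : R, 0 <= t <= 1 -> differentiable phi (x + t *: (y - x)) /\
    0 <= dot (y - x) (grad phi (x + t *: (y - x)))) ->
  phi x <= phi y.
Proof.
move=> hphi; pose g (u : R) := phi (x + u *: (y - x)).
have hg (t : R) : 0 <= t <= 1 ->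
    is_derive t 1 g (dot (y - x) (grad phi (x + t *: (y - x)))).
  by move=> /hphi[d _]; exact: is_derive_line.
have itvW (t : R) : t \in `]0, 1[%R -> 0 <= t <= 1.
  by rewrite in_itv/= => /andP[t0 t1]; rewrite !ltW.
suff : g 0 <= g 1 by rewrite /g scale0r addr0 scale1r addrC subrK.
apply: (@ger0_derive1_ndecr R g 0 1) => //.
- by move=> t /itvW /hg [].
- by move=> t /itvW t01; have [_] := hg _ t01; rewrite derive1E => ->;
    case: (hphi _ t01).
- apply: derivable_within_continuous => t; rewrite in_itv/= => t01.
  by have [] := hg _ t01.
Qed.

(** If [dot (x - a) (H x)] is not positive, where [a] is a solution, then
pseudomonotonicity makes the potential nondecreasing from [x] to [a], and from
[a] to any point of [X]; so [x] minimizes it on [X] and is a solution. *)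
Lemma pseudomonotone_gradient_acute (phi : 'rV[R]_n -> R) :
  (forall x, X x -> differentiable phi x /\ grad phi x = H x) ->
  pseudomonotone X H -> acute_angle X H.
Proof.
move=> phiP pH.
have phi_le x y : X x -> X y -> 0 <= dot (y - x) (H x) -> phi x <= phi y.
  move=> Xx Xy xy; apply: le_of_segment_grad => t /[dup] t01 /andP[t0 _].
  have Xz : X (x + t *: (y - x)) by exact: convex_setP.
  have [? ->] := phiP _ Xz; split=> //.
  have [->|tn0] := eqVneq t 0; first by rewrite scale0r addr0.
  have {}t0 : 0 < t by rewrite lt_neqAle eq_sym tn0.
  have := pH _ _ Xz Xx; rewrite addrAC subrr add0r !dotZl.
  by rewrite !pmulr_rge0//; exact.
move=> x a [Xx nx] [Xa ha]; rewrite ltNge; apply/negP => h; apply: nx.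
have xa : phi x <= phi a.
  by apply: phi_le => //; rewrite -opprB dotNl oppr_ge0.
split=> // y Xy; have [dx gx] := phiP _ Xx.
rewrite dotC -gx -[grad phi x]addr0.
apply: (first_order_min cX Xx dx _ Xy) => z Xz.
by rewrite dot0l addr0 (le_trans xa)// phi_le// ha.
Qed.

(** The acute angle relation only speaks of points that are not solutions;
continuity extends its weak form to solutions. *)
Lemma acute_angle_ge0 (L : R) :
  (forall x y, X x -> X y -> `|H x - H y| <= L * `|x - y|) ->
  acute_angle X H ->
  forall a b, SVI X H a -> X b -> 0 <= dot (b - a) (H b).
Proof.
move=> HL aH a b sa Xb; have [Xa ha] := sa.
have [sb|nb] := pselect (SVI X H b); last by apply/ltW/aH.
rewrite leNgt; apply/negP => e0.
set e := dot _ _ in e0; pose K := n%:R * `|b - a| * (`|L| * `|a - b|).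
have K0 : 0 <= K by rewrite !mulr_ge0.
(* A point [z] of the segment close enough to [b] for [dot (b - a) (H z)] to be
   negative, by continuity: it is not a solution, as [b] shows, but violates
   the acute angle relation. *)
pose t := Num.min (2^-1) (- e / (2 * (K + 1))).
have t0 : 0 < t.
  by rewrite lt_min invr_gt0 ltr0n /= divr_gt0 ?oppr_gt0// mulr_gt0// ltr_wpDl.
have t2 : t <= 2^-1 by rewrite ge_min lexx.
have tK : t * K <= - e / 2.
  have : t <= - e / (2 * (K + 1)) by rewrite ge_min lexx orbT.
  rewrite ler_pdivlMr; last by rewrite mulr_gt0// ltr_wpDl.
  by move=> ?; nra.
pose z := b + t *: (a - b).
have Xz : X z by apply: convex_setP => //; rewrite (ltW t0)/= (le_trans t2)//; lra.
have hz : dot (b - a) (H z) < 0.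
  have -> : H z = H b + (H z - H b) by rewrite addrC subrK.
  rewrite dotDr -/e.
  have := ler_norm_dot (b - a) (H z - H b) => /ler_normlW h.
  have h2 : n%:R * `|b - a| * `|H z - H b| <= t * K.
    rewrite /K mulrCA ler_wpM2l ?mulr_ge0// (le_trans (HL _ _ Xz Xb))//.
    rewrite /z addrAC subrr add0r normrZ gtr0_norm// mulrCA.
    by apply: ler_wpM2l; [exact: ltW|rewrite ler_wpM2r// ler_norm].
  lra.
have nz : ~ SVI X H z.
  case=> _ /(_ _ Xb); rewrite /z opprD addrA subrr add0r -scalerN opprB dotZl.
  by rewrite pmulr_rge0// leNgt -/z hz.
have := aH _ _ (conj Xz nz) sa.
have -> : z - a = (1 - t) *: (b - a).
  by rewrite /z scalerBl scale1r -(opprB b a) scalerN addrAC.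
rewrite dotZl pmulr_rgt0; last by lra.
by rewrite ltNge (ltW hz).
Qed.

End AcuteAngle.

(** * Real sequences and series *)

Section RealSequences.
Context {R : realType}.
Implicit Types (a u e d rho gamma : nat -> R).

Lemma seriesSrE u k : series u k.+1 = series u k + u k.
Proof. by rewrite seriesSr. Qed.

Lemma series0 u : series u 0%N = 0.
Proof. by rewrite /series /= big_geq. Qed.

Lemma cvgn_bound u : cvgn u -> exists2 B, 0 < B & forall k, `|u k| <= B.
Proof.
by move=> /cvg_seq_bounded/pinfty_ex_gt0[B B0 uB]; exists B => // k; exact: uB.
Qed.

Lemma cvgn_series_sum n (f : 'I_n -> nat -> R) :
  (forall i, cvgn (series (f i))) ->
  cvgn (series (fun k => \sum_(i < n) f i k)).
Proof.
elim: n f => [|n IH] f hf.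
  rewrite (_ : (fun k => _) = fun=> 0); last by apply/funext => k; rewrite big_ord0.
  rewrite (_ : series _ = cst 0); first exact: is_cvg_cst.
  by apply/funext => k; rewrite /series /= big1.
rewrite (_ : (fun k => _) =
  (fun k => \sum_(i < n) f (widen_ord (leqnSn n) i) k) + f ord_max); last first.
  by apply/funext => k; rewrite big_ord_recr.
by apply: is_cvg_seriesD => //; apply: IH.
Qed.

Lemma nonincreasing_bounded_cvgn u m :
  (forall k, u k.+1 <= u k) -> (forall k, m <= u k) -> cvgn u.
Proof.
move=> du mu; apply: nonincreasing_is_cvgn; first exact/nonincreasing_seqP.
by exists m => _ [k _ <-].
Qed.

Lemma nondecreasing_bounded_cvgn u m :
  (forall k, u k <= u k.+1) -> (forall k, u k <= m) -> cvgn u.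
Proof.
move=> du mu; apply: nondecreasing_is_cvgn; first exact/nondecreasing_seqP.
by exists m => _ [k _ <-].
Qed.

(** Pathwise form of the Robbins-Siegmund lemma: a nonnegative sequence that
decreases up to convergent perturbations converges, and the sum of its
decrements is finite. *)
Lemma robbins_siegmund a u e :
  (forall k, 0 <= a k) -> (forall k, 0 <= u k) ->
  (forall k, a k.+1 <= a k - u k + e k) -> cvgn (series e) ->
  cvgn a /\ cvgn (series u).
Proof.
move=> a0 u0 step ce; have [B B0 eB] := cvgn_bound ce.
have su0 k : 0 <= series u k by rewrite sumr_ge0.
pose b k := a k - series e k + series u k.
have db k : b k.+1 <= b k.
  by rewrite /b !seriesSrE; have := step k; lra.
have cb : cvgn b.
  apply: (@nonincreasing_bounded_cvgn _ (- B)) => // k.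
  by have := eB k; rewrite ler_norml /b => /andP[]; have := a0 k; have := su0 k; lra.
have cu : cvgn (series u).
  have b0 k : b k <= b 0%N by elim: k => // k; apply: le_trans.
  apply: (@nondecreasing_bounded_cvgn _ (b 0%N + B)) => k.
    by rewrite seriesSrE lerDl.
  have := b0 k; rewrite {1}/b => h.
  by have := eB k; rewrite ler_norml => /andP[]; have := a0 k; lra.
split=> //.
rewrite (_ : a = b + series e - series u); last first.
  by apply/funext => k; rewrite /b !fctE; lra.
by apply: is_cvgB => //; apply: is_cvgD.
Qed.

Lemma abel_summation rho d k :
  series (fun j => rho j * d j) k =
  rho k * series d k - series (fun j => series d j.+1 * (rho j.+1 - rho j)) k.
Proof.
by elim: k => [|k IH]; [rewrite !series0; ring|rewrite !seriesSrE IH; ring].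
Qed.

Lemma abel_bound rho d B : (forall k, 0 <= rho k) ->
  (forall k, rho k <= rho k.+1) -> (forall k, `|series d k| <= B) ->
  forall k, `|series (fun j => rho j * d j) k| <= 2 * B * rho k.
Proof.
move=> rho0 rhoS dB k; have B0 : 0 <= B by exact: le_trans (dB 0%N).
suff h : `|series (fun j => series d j.+1 * (rho j.+1 - rho j)) k|
    <= B * (rho k - rho 0%N).
  rewrite abel_summation (le_trans (ler_normB _ _))// normrM ger0_norm//.
  have h1 : rho k * `|series d k| <= rho k * B by rewrite ler_wpM2l.
  have h2 : 0 <= B * rho 0%N by rewrite mulr_ge0.
  lra.
elim: k => [|k IH]; first by rewrite series0 subrr mulr0 normr0.
rewrite seriesSrE (le_trans (ler_normD _ _))//.
have -> : B * (rho k.+1 - rho 0%N) =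
  B * (rho k - rho 0%N) + B * (rho k.+1 - rho k) by ring.
by rewrite lerD// normrM [X in _ * X]ger0_norm ?subr_ge0// ler_wpM2r// subr_ge0.
Qed.

(** Abel's test. *)
Lemma abel_cvg rho d M : (forall k, rho k <= rho k.+1) ->
  (forall k, rho k <= M) -> cvgn (series d) ->
  cvgn (series (fun j => rho j * d j)).
Proof.
move=> rhoS rhoM cd; have [B B0 dB] := cvgn_bound cd.
have cr : cvgn rho by exact: nondecreasing_bounded_cvgn rhoM.
rewrite (_ : series _ = rho * series d -
    series (fun j => series d j.+1 * (rho j.+1 - rho j))); last first.
  by apply/funext => k; rewrite abel_summation.
apply: is_cvgB; first exact: is_cvgM.
apply: normed_cvg.
apply: (@series_le_cvg _ _ (fun j => B * (rho j.+1 - rho j)))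
  => [k|k|k|] /=; first by [].
- by rewrite mulr_ge0 ?subr_ge0// ltW.
- by rewrite normrM [X in _ * X]ger0_norm ?subr_ge0// ler_wpM2r// subr_ge0.
- rewrite (_ : series _ = cst B * (rho - cst (rho 0%N))).
    by apply: is_cvgM; [exact: is_cvg_cst|apply: is_cvgB => //; exact: is_cvg_cst].
  apply/funext; elim=> [|k IH]; first by rewrite series0 !fctE subrr mulr0.
  by rewrite seriesSrE IH !fctE; ring.
Qed.

(** Running maximum of a sequence, bounded below by 1. *)
Fixpoint runmax a k : R :=
  if k is j.+1 then Num.max (runmax a j) (a k) else Num.max 1 (a 0%N).

Lemma runmaxS a k : runmax a k <= runmax a k.+1.
Proof. by rewrite /= le_max lexx. Qed.

Lemma runmax_ge1 a k : 1 <= runmax a k.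
Proof.
by elim: k => [|k IH]; [rewrite /= le_max lexx|exact: le_trans (runmaxS _ _)].
Qed.

Lemma le_runmax a k : a k <= runmax a k.
Proof. by case: k => [|k]; rewrite /= le_max lexx orbT. Qed.

(** Only the indices at which a new maximum is reached matter. *)
Lemma runmax_bound a C C' : 0 <= C -> 0 <= C' ->
  (forall k, a k ^+ 2 <= C + C' * runmax a k) ->
  forall k, runmax a k <= 1 + C + C'.
Proof.
move=> C0 C'0 h.
have key k : runmax a k = a k -> runmax a k <= 1 + C + C'.
  move=> E; have := h k; have := runmax_ge1 a k; rewrite E => a1 hk.
  have : a k * a k <= (C + C') * a k.
    have : C <= C * a k by rewrite ler_peMr.
    by move: hk; rewrite expr2; lra.
  by rewrite ler_pM2r ?(lt_le_trans ltr01)// => ?; lra.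
elim=> [|k IH].
  have [h1|/ltW h1] := leP 1 (a 0%N); first by apply: key; rewrite /= max_r.
  by rewrite /= max_l//; lra.
have [h1|/ltW h1] := leP (runmax a k) (a k.+1).
  by apply: key; rewrite /= max_r.
by rewrite /= max_l.
Qed.

Lemma inf_often_small gamma a : (forall k, 0 < gamma k) -> (forall k, 0 <= a k) ->
  series gamma @ \oo --> +oo -> cvgn (series (fun k => gamma k * a k)) ->
  forall eps N, 0 < eps -> exists2 k, (N <= k)%N & a k < eps.
Proof.
move=> g0 a0 gy cga eps N e0; apply: contrapT => hN.
(* Otherwise [gamma k] is dominated by [gamma k * a k / eps] from [N] on. *)
have {}hN k : (N <= k)%N -> eps <= a k.
  by move=> Nk; rewrite leNgt; apply/negP => ak; apply: hN; exists k.
have [B B0 hB] := cvgn_bound cga.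
have : cvgn (series gamma).
  apply: (@nondecreasing_bounded_cvgn _ (series gamma N + B / eps)) => k.
    by rewrite seriesSrE lerDl ltW.
  have [kN|/ltnW Nk] := leqP k N.
    rewrite (@le_trans _ _ (series gamma N))//; last first.
      by rewrite lerDl divr_ge0// ltW.
    rewrite -subr_ge0 sub_series_geq// sumr_ge0// => j _; exact: ltW.
  rewrite -lerBlDl sub_series_geq// ler_pdivlMr// mulr_suml.
  apply: (@le_trans _ _ (\sum_(N <= j < k) gamma j * a j)).
    by rewrite big_nat [leRHS]big_nat ler_sum// => j /andP[Nj _];
      rewrite ler_wpM2l ?hN// ltW.
  rewrite -sub_series_geq//.
  have : 0 <= series (fun j => gamma j * a j) N.
    by rewrite sumr_ge0// => j _; rewrite mulr_ge0// ltW.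
  by have := ler_normlW (hB k); lra.
move=> /cvgn_bound[C C0 hC].
by move/cvgryPge: gy => /(_ (C + 1)) [M _ /(_ M (leqnn M))];
  have := ler_normlW (hC M); lra.
Qed.

End RealSequences.

(** * Convergence along a single path *)

Lemma cvgn0_of_inf_often (R : realType) (a : nat -> R) : (forall k, 0 <= a k) ->
  cvgn a -> (forall eps N, 0 < eps -> exists2 k, (N <= k)%N & a k < eps) ->
  a @ \oo --> 0.
Proof.
move=> a0 ca small; suff <- : limn a = 0 by [].
apply/eqP; rewrite eq_le; apply/andP; split; last first.
  by apply: limr_ge => //; apply: nearW.
rewrite leNgt; apply/negP => l0.
have [N _ hN] : \forall k \near \oo, limn a / 2 < a k.
  by apply: (cvgr_gt _ ca); rewrite ltr_pdivrMr// ltr_pMr// ltr1n.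
have [|k Nk] := small (limn a / 2) N; first by rewrite divr_gt0.
by have := hN k Nk; lra.
Qed.

Lemma cluster_seqP (R : realType) n (u : nat -> 'rV[R]_n) p :
  cluster (u @ \oo) p ->
  forall eps N, 0 < eps -> exists2 k, (N <= k)%N & `|p - u k| < eps.
Proof.
move=> cp eps N e0.
have [|_ [[k /= Nk <-] pk]] := cp (u @` [set k | (N <= k)%N]) (ball p eps) _
  (nbhsx_ballx p eps e0).
  by exists N => // k /= Nk; exists k.
by exists k => //; move: pk; rewrite -ball_normE.
Qed.

(** In this section a single path of the scheme is fixed: [x], [xh] are the
iterates and half-iterates, [w], [wh] the noises, [H] the mean map. Besides the
hypotheses of the problem, the path is assumed to make four kinds of random
series converge. *)
Section Path.
Context {R : realType} {n : nat}.
Variables (X : set 'rV[R]_n) (nrm : 'rV[R]_n -> R) (s : 'rV[R]_n -> R).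
Variables (theta LV : R) (H : 'rV[R]_n -> 'rV[R]_n) (L Bs : R).
Hypotheses (clX : closed X) (cX : convex_set (M := 'rV[R]_n) X).
Hypotheses (nrmP : is_norm nrm) (sP : prox_function nrm X s theta LV).
Hypothesis HL : forall x y, X x -> X y -> `|H x - H y| <= L * `|x - y|.
Hypothesis HB : forall x, X x -> dual_norm nrm (H x) <= Bs / 2.
Hypothesis aH : acute_angle X H.
Variables (x xh w wh : nat -> 'rV[R]_n) (gamma : nat -> R) (xs : 'rV[R]_n).
Hypothesis sxs : SVI X H xs.
Hypothesis x0X : X (x 0%N).
Hypothesis gamma_gt0 : forall k, 0 < gamma k.
Hypothesis xhP : forall k, prox X s (x k) (gamma k *: (H (x k) + w k)) (xh k).
Hypothesis xP :
  forall k, prox X s (x k) (gamma k *: (H (xh k) + wh k)) (x k.+1).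
Hypothesis sum_gamma : series gamma @ \oo --> +oo.
Hypothesis sum_gamma2 : cvgn (series (fun k => gamma k ^+ 2)).
Hypothesis sum_w :
  cvgn (series (fun k => gamma k ^+ 2 * dual_norm nrm (w k) ^+ 2)).
Hypothesis sum_wh :
  cvgn (series (fun k => gamma k ^+ 2 * dual_norm nrm (wh k) ^+ 2)).
Hypothesis noise1 : forall i, cvgn (series (fun k => gamma k * wh k 0 i)).
(* The normalization [rho] makes the coefficients of the noise in [noise2]
   bounded by 1. *)
Let a k := `|xh k - xs|.
Let rho := runmax a.
Hypothesis noise2 : forall i,
  cvgn (series (fun k => gamma k * ((xh k - xs) 0 i / rho k * wh k 0 i))).

Let Xx k : X (x k). Proof. by case: k => [//|k]; case: (xP k). Qed.
Let Xxh k : X (xh k). Proof. by case: (xhP k). Qed.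
Let Xxs : X xs. Proof. by case: sxs. Qed.

(* The remainder [r] bounds the squared dual norm of the difference between the
   two steps, as the mean map varies by at most [Bs] on [X]. *)
Let r k := 3 * (gamma k ^+ 2 * (Bs ^+ 2) +
  gamma k ^+ 2 * dual_norm nrm (w k) ^+ 2 +
  gamma k ^+ 2 * dual_norm nrm (wh k) ^+ 2).

Let V k y := bregman s (x k) y.

Let step k y : X y ->
  V k.+1 y + V k (xh k) <=
  V k y - gamma k * dot (xh k - y) (H (xh k)) - gamma k * dot (wh k) (xh k - y)
    + r k.
Proof.
move=> Xy; have := mirror_prox_step nrmP cX sP (Xx k) Xy (xhP k) (xP k).
move=> /le_trans; apply; rewrite dotZl dotDl mulrDr (dotC (H _)) opprD addrA lerD2l.
rewrite -scalerBr.
set v := H _ + _ - _.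
have -> : dual_norm nrm (gamma k *: v) = gamma k * dual_norm nrm v.
  have le c (u : 'rV[R]_n) : 0 < c -> dual_norm nrm (c *: u) <= c * dual_norm nrm u.
    move=> c0; apply: dual_norm_le => // z z1; rewrite dotZr ler_pM2l//.
    by rewrite (le_trans (dot_le_dual nrmP _ _))// ler_piMl// dual_norm_ge0.
  apply/eqP; rewrite eq_le le//=.
  rewrite -ler_pdivlMl//; have := @le (gamma k)^-1 (gamma k *: v).
  by rewrite scalerA mulVf ?gt_eqF// scale1r; apply; rewrite invr_gt0.
have hv : dual_norm nrm v <= Bs + dual_norm nrm (w k) + dual_norm nrm (wh k).
  rewrite /v addrC opprD addrACA.
  have t := dual_norm_triangle nrmP.
  apply: le_trans (t _ _) _; have := t (- H (x k)) (H (xh k)); have := t (- w k) (wh k).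
  rewrite !dual_normN//; have := HB (Xx k); have := HB (Xxh k); lra.
have v0 := dual_norm_ge0 nrmP v.
have {}hv : dual_norm nrm v ^+ 2 <=
    (Bs + dual_norm nrm (w k) + dual_norm nrm (wh k)) ^+ 2.
  by rewrite ler_pXn2r// nnegrE// (le_trans v0).
have -> : r k = gamma k ^+ 2 *
    (3 * (Bs ^+ 2 + dual_norm nrm (w k) ^+ 2 + dual_norm nrm (wh k) ^+ 2)).
  by rewrite /r; ring.
rewrite exprMn; apply: ler_wpM2l; first exact: sqr_ge0.
apply: le_trans hv _.
move: (dual_norm nrm (w k)) (dual_norm nrm (wh k)) => p q.
have := sqr_ge0 (Bs - p); have := sqr_ge0 (Bs - q); have := sqr_ge0 (p - q).
rewrite !expr2; lra.
Qed.

Let V0 k y : X y -> 0 <= V k y.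
Proof. by move=> Xy; exact: (bregman_ge0 sP). Qed.

Let U0 k y : SVI X H y -> 0 <= dot (xh k - y) (H (xh k)).
Proof. by move=> sy; exact: (acute_angle_ge0 cX HL aH). Qed.

Let sum_r : cvgn (series r).
Proof.
rewrite (_ : r = 3 *: (Bs ^+ 2 *: (fun k => gamma k ^+ 2) +
  (fun k => gamma k ^+ 2 * dual_norm nrm (w k) ^+ 2) +
  (fun k => gamma k ^+ 2 * dual_norm nrm (wh k) ^+ 2))); last first.
  apply/funext => k; rewrite /r !fctE /GRing.scale /=.
  by rewrite [gamma k ^+ 2 * Bs ^+ 2]mulrC.
by apply: is_cvg_seriesZ; do 2!apply: is_cvg_seriesD => //; apply: is_cvg_seriesZ.
Qed.

(* [rho k * d k] is the noise term of the one-step estimate at [y := xs]. *)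
Let d k := \sum_(i < n) gamma k * ((xh k - xs) 0 i / rho k * wh k 0 i).

Let rho_gt0 k : 0 < rho k.
Proof. exact: lt_le_trans ltr01 (runmax_ge1 _ _). Qed.

Let rho_d k : rho k * d k = gamma k * dot (wh k) (xh k - xs).
Proof.
rewrite /d /dot !mulr_sumr; apply: eq_bigr => i _.
by have := rho_gt0 k => /gt_eqF/negbT rk; field.
Qed.

Let cvg_d : cvgn (series d).
Proof. exact: cvgn_series_sum. Qed.

Let T := series (fun j => rho j * d j).

Let sumstep k : V k xs + series (fun j => V j (xh j)) k <=
  V 0%N xs - T k + series r k.
Proof.
elim: k => [|k IH]; first by rewrite /T !series0; lra.
rewrite /T !seriesSrE -/T rho_d.
have := step k Xxs; have : 0 <= gamma k * dot (xh k - xs) (H (xh k)).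
  by rewrite mulr_ge0 ?U0// ltW.
lra.
Qed.

Let rho_bounded : exists M, forall k, rho k <= M.
Proof.
have [B B0 dB] := cvgn_bound cvg_d.
have [Br Br0 rB] := cvgn_bound sum_r.
have [c c0 hc] := sup_le_nrm nrmP.
(* Both terms of the bound on [a k] are controlled: [V k xs] by the estimate
   summed up to [k], [V k (xh k)] by the estimate summed up to [k.+1]. *)
have TB k : `|T k| <= 2 * B * rho k.
  by apply: abel_bound => // j; [exact: ltW|exact: runmaxS].
have TB1 k : `|T k.+1| <= 4 * B * rho k.
  rewrite /T seriesSrE -/T (le_trans (ler_normD _ _))//.
  have := TB k; suff : `|rho k * d k| <= 2 * B * rho k by lra.
  rewrite normrM gtr0_norm// mulrC ler_pM2r//.
  have -> : d k = series d k.+1 - series d k by rewrite seriesSrE addrC addKr.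
  by rewrite (le_trans (ler_normB _ _))//; have := dB k; have := dB k.+1; lra.
have sV0 k : 0 <= series (fun j => V j (xh j)) k.
  by rewrite sumr_ge0// => j _; exact: V0.
pose Q := V 0%N xs + Br.
have Q0 : 0 <= Q by rewrite addr_ge0 ?V0// ltW.
have VQ k : V k xs <= Q + 2 * B * rho k.
  have := sumstep k; have := sV0 k; have := ler_normlW (rB k).
  by have := TB k; rewrite /Q ler_norml => /andP[]; lra.
have VhQ k : V k (xh k) <= Q + 4 * B * rho k.
  have := sumstep k.+1; rewrite [series (fun j => V j _) _]seriesSrE.
  have := sV0 k; have := ler_normlW (rB k.+1).
  have := V0 k.+1 Xxs.
  by have := TB1 k; rewrite /Q ler_norml => /andP[]; lra.
exists (1 + 8 * c ^+ 2 * Q + 24 * c ^+ 2 * B); apply: runmax_bound.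
- by rewrite !mulr_ge0// ltW.
- by rewrite !mulr_ge0// ltW.
move=> k; rewrite -/rho.
have ak : a k <= c * (nrm (x k - xh k) + nrm (x k - xs)).
  rewrite /a (le_trans (hc _))// ler_pM2l//.
  have := nrm_triangle nrmP (xh k - x k) (x k - xs).
  by rewrite addrA subrK (nrm_sub nrmP (xh k)).
have h1 := bregman_lower sP (Xx k) (Xxh k).
have h2 := bregman_lower sP (Xx k) Xxs.
have a2 : a k ^+ 2 <= (c * (nrm (x k - xh k) + nrm (x k - xs))) ^+ 2.
  by rewrite ler_pXn2r ?nnegrE ?normr_ge0// (le_trans _ ak)// normr_ge0.
apply: (le_trans a2); rewrite exprMn.
rewrite [leRHS](_ : _ = c ^+ 2 * (8 * Q + 24 * B * rho k)); last by ring.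
rewrite ler_wpM2l ?sqr_ge0//.
have := VQ k; have := VhQ k; rewrite /V.
move: h1 h2; move: (nrm (x k - xh k)) (nrm (x k - xs)) (bregman _ _ _)
  (bregman _ _ _) => p q b1 b2.
rewrite -!mulrA; move: (Q) (B * rho k) => Q' b h1 h2 h3 h4.
move: h1 h2 h3 h4; have := sqr_ge0 (p - q); rewrite !expr2; lra.
Qed.

Let cvg_T : cvgn T.
Proof.
have [M hM] := rho_bounded.
exact: (abel_cvg (runmaxS a) hM cvg_d).
Qed.

(* The noise series for [y] differs from the one for [xs] by a fixed linear
   combination of the series of [noise1]. *)
Let cvg_noise y : cvgn (series (fun k => gamma k * dot (wh k) (xh k - y))).
Proof.
rewrite (_ : (fun k => _) = (fun k => rho k * d k) +
  (fun k => \sum_(i < n) (xs - y) 0 i * (gamma k * wh k 0 i))); last first.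
  apply/funext => k; rewrite !fctE rho_d.
  rewrite -[xh k - y](subrKA xs) [dot _ (_ + (_ - y))]dotDr mulrDr; congr (_ + _).
  by rewrite /dot mulr_sumr; apply: eq_bigr => i _; rewrite mulrA mulrC.
apply: is_cvg_seriesD; first exact: cvg_T.
apply: (cvgn_series_sum (f := fun i k => (xs - y) 0 i * (gamma k * wh k 0 i))) => i.
exact: (is_cvg_seriesZ (k := (xs - y) 0 i) (@noise1 i)).
Qed.

Let robbins y : SVI X H y ->
  cvgn (fun k => V k y) /\
  cvgn (series (fun k => gamma k * dot (xh k - y) (H (xh k)) + V k (xh k))).
Proof.
move=> sy; have [Xy _] := sy.
apply: (@robbins_siegmund _ _ _ (r - (fun k => gamma k * dot (wh k) (xh k - y)))).
- by move=> k; exact: V0.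
- by move=> k; rewrite addr_ge0 ?V0// mulr_ge0 ?U0// ltW.
- by move=> k; have := step k Xy; rewrite !fctE; lra.
- by apply: is_cvg_seriesB.
Qed.

Let cvg_gap : cvgn (series (fun k => gamma k * dot (xh k - xs) (H (xh k)))).
Proof.
have [_ h] := robbins sxs; apply: series_le_cvg h => k /=.
- by rewrite mulr_ge0 ?U0// ltW.
- by rewrite addr_ge0 ?V0// mulr_ge0 ?U0// ltW.
- by rewrite lerDl V0.
Qed.

Let cvg_Vh : (fun k => V k (xh k)) @ \oo --> 0.
Proof.
have [_ /cvg_series_cvg_0 h] := robbins sxs.
apply: (squeeze_cvgr _ (cvg_cst 0) h); apply: nearW => k.
by rewrite V0//= lerDr mulr_ge0 ?U0// ltW.
Qed.

(* Some cluster point [p] of the half-iterates is a solution. *)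
Let solution_cluster : exists2 p, SVI X H p &
  forall eps N, 0 < eps -> exists2 k, (N <= k)%N & `|p - xh k| < eps.
Proof.
pose g k := dot (xh k - xs) (H (xh k)).
have /choice[f fP] : forall j, exists k, (j <= k)%N /\ g k < (j.+1%:R)^-1.
  move=> j; have g0 k : 0 <= g k by exact: U0.
  have [|k jk gk] := @inf_often_small _ gamma g gamma_gt0 g0 sum_gamma cvg_gap
    (j.+1%:R)^-1 j; first by rewrite invr_gt0 ltr0n.
  by exists k.
have [M hM] := rho_bounded.
have [C C0 hC] := sup_le_dual nrmP.
have cK : compact (X `&` closed_ball xs (Num.max 1 M)).
  have M0 : 0 < Num.max 1 M by rewrite lt_max ltr01.
  apply: bounded_closed_compact.
    exists (`|xs| + Num.max 1 M); split; first exact: num_real.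
    move=> e he z [_]; rewrite closed_ballE// /closed_ball_ /= => h.
    apply: le_trans (ltW he); rewrite -[z](subrK xs) addrC (le_trans (ler_normD _ _))//.
    by rewrite lerD2l distrC.
  by apply: closedI => //; exact: closed_ball_closed.
have [|p [[Xp _] pc]] := cK ((xh \o f) @ \oo) _.
  exists 0%N => // k _ /=; split; first exact: Xxh.
  rewrite closed_ballE ?lt_max ?ltr01// /closed_ball_ /= distrC le_max.
  by rewrite (le_trans (le_runmax a (f k)) (hM _)) orbT.
have {}pc := cluster_seqP pc.
exists p; last first.
  move=> eps N e0; have [j Nj pj] := pc eps N e0.
  by exists (f j) => //; case: (fP j) => jf _; exact: leq_trans Nj jf.
apply: contrapT => np.
have d0 := aH (conj Xp np) sxs; set de := dot _ _ in d0.
(* [K] bounds the rate at which the gap [dot (z - xs) (H z)] can decrease when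
   [z] moves away from [p]. *)
pose K := n%:R * (C * (`|Bs| / 2)) + n%:R * `|p - xs| * `|L|.
have K0 : 0 <= K by rewrite addr_ge0// !mulr_ge0// ltW.
have lip z : X z -> de - dot (z - xs) (H z) <= K * `|p - z|.
  move=> Xz.
  have -> : de - dot (z - xs) (H z) = dot (p - z) (H z) + dot (p - xs) (H p - H z).
    by rewrite /de dotBr !dotBl; ring.
  have h1 := ler_normlW (ler_norm_dot (p - z) (H z)).
  have h2 := ler_normlW (ler_norm_dot (p - xs) (H p - H z)).
  apply: le_trans (lerD h1 h2) _; rewrite /K mulrDl; apply: lerD.
    rewrite mulrAC ler_wpM2r// ler_wpM2l// (le_trans (hC _))// ler_pM2l//.
    by rewrite (le_trans (HB Xz))// ler_pM2r// ler_norm.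
  rewrite -[leRHS]mulrA ler_wpM2l ?mulr_ge0// (le_trans (HL Xp Xz))//.
  by rewrite ler_wpM2r// ler_norm.
have [N hN] : exists N, forall j, (N <= j)%N -> (j.+1%:R)^-1 < de / 2.
  have := @near_infty_natSinv_lt R (PosNum (divr_gt0 d0 (ltr0n R 2))).
  by move=> [N _ hN]; exists N => j Nj; exact: hN.
have [|j Nj pj] := pc (de / (2 * (K + 1))) N.
  by rewrite divr_gt0// mulr_gt0// ltr_wpDl.
have [_ gj] := fP j; have := hN _ Nj; have := lip _ (Xxh (f j)).
move: pj; rewrite /= ltr_pdivlMr ?mulr_gt0 ?ltr_wpDl// => pj h1 h2.
have : g (f j) < de / 2 by exact: lt_trans gj h2.
rewrite /g; have : 0 <= `|p - xh (f j)| by [].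
move: pj h1; move: (`|p - xh (f j)|) => q; nra.
Qed.

(** Along the path, the iterates converge to a solution, which depends on the
path. *)
Lemma path_convergence : exists2 p, SVI X H p & x @ \oo --> p.
Proof.
have [p sp hp] := solution_cluster; exists p => //.
have [Xp _] := sp.
have [c c0 hc] := sup_le_nrm nrmP.
have [C C0 hC] := nrm_le_sup nrmP.
have [_ _ _ [LV0 _] VLV] := sP.
have Vp0 : (fun k => V k p) @ \oo --> 0.
  (* [V k p] converges, and is small infinitely often because [p] is a cluster
     point of [xh] and [x k - xh k] tends to 0. *)
  apply: cvgn0_of_inf_often; first by move=> k; exact: V0.
    by case: (robbins sp).
  move=> eps N e0; pose q := eps / (LV ^+ 2 * 8).
  have q0 : 0 < q by rewrite divr_gt0// mulr_gt0// exprn_gt0.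
  have [N1 _ hN1] : \forall k \near \oo, V k (xh k) < q.
    exact: (cvgr_lt _ cvg_Vh q q0).
  have [|k Nk pk] := hp (Num.sqrt q / C) (maxn N N1).
    by rewrite divr_gt0// sqrtr_gt0.
  rewrite geq_max in Nk; have /andP[Nk1 Nk2] := Nk.
  exists k => //; rewrite /V (le_lt_trans (VLV _ _ (Xx k) Xp))//.
  have h1 := bregman_lower sP (Xx k) (Xxh k).
  have h2 := hN1 k Nk2; rewrite /V in h2.
  have h3 : nrm (xh k - p) ^+ 2 < q.
    rewrite -[ltRHS]sqr_sqrtr ?(ltW q0)// ltr_pXn2r ?nnegrE ?nrm_ge0 ?sqrtr_ge0//.
    rewrite (le_lt_trans (hC _))// mulrC -ltr_pdivlMr// distrC //.
  have h4 := nrm_triangle nrmP (x k - xh k) (xh k - p); rewrite subrKA in h4.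
  have h5 : nrm (x k - p) ^+ 2 <= (nrm (x k - xh k) + nrm (xh k - p)) ^+ 2.
    by rewrite ler_pXn2r ?nnegrE ?addr_ge0 ?nrm_ge0.
  have h6 : nrm (x k - p) ^+ 2 < 8 * q.
    apply: le_lt_trans h5 _; move: h1 h2 h3.
    move: (nrm (x k - xh k)) (nrm (xh k - p)) => u v h1 h2 h3.
    have := sqr_ge0 (u - v); rewrite !expr2; lra.
  have -> : eps = LV ^+ 2 * (8 * q).
    by rewrite /q; field; rewrite gt_eqF.
  by rewrite ltr_pM2l// exprn_gt0.
apply/cvgrPdist_lt => eps e0.
have q0 : 0 < (eps / c) ^+ 2 / 2 by rewrite divr_gt0// exprn_gt0// divr_gt0.
have [N _ hN] := cvgr_lt _ Vp0 _ q0; exists N => //= k /hN hk.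
have h1 := bregman_lower sP (Xx k) Xp.
rewrite distrC (le_lt_trans (hc _))// mulrC -ltr_pdivlMr//.
rewrite -(@ltr_pXn2r _ 2%N) ?nnegrE ?nrm_ge0 ?divr_ge0 ?ltW//.
by rewrite /V in hk; lra.
Qed.

End Path.

(** * Orthogonality of martingale differences *)

Section Condexp.
Context {R : realType} {dS : measure_display} {S : measurableType dS}.
Variable Q : probability S R.
Implicit Types (G : set_system S).

Lemma measurable_fun_sub G dT (T : measurableType dT) (f : S -> T) :
  (<<s G >> `<=` measurable) ->
  measurable_fun setT (f : g_sigma_algebraType G -> T) ->
  measurable_fun setT f.
Proof. by move=> GS mf _ B mB; apply: GS; apply: mf. Qed.

Lemma bounded_forall (T : Type) (f : T -> R) (K : R) (D : set T) :
  (forall t, `|f t| <= K) -> [bounded f t | t in D].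
Proof.
move=> fK; exists K; split; first exact: num_real.
by move=> M KM t _; exact: le_trans (fK t) (ltW KM).
Qed.

Import HBNNSimple.

Let nnsfun_mul0 G (w : S -> R) (h : {nnsfun (g_sigma_algebraType G) >-> R}) :
  (<<s G >> `<=` measurable) ->
  Q.-integrable setT (EFin \o w) ->
  (forall A, <<s G >> A -> (\int[Q]_(t in A) (w t)%:E = 0)%E) ->
  (\int[Q]_t (w t * h t)%:E = 0)%E.
Proof.
move=> GS iw w0.
have mh y : <<s G >> (h @^-1` [set y]).
  by rewrite -[X in <<s G >> X]setTI; exact: (@measurable_funPT _ _ _ _ h).
have E t : (w t * h t)%:E = (\sum_(y <- finmap.enum_fset (fset_set (range h)))
    (y%:E * (w t * \1_(h @^-1` [set y]) t)%:E))%E.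
  rewrite fimfunE fsbig_finite//= mulr_sumr -sumEFin.
  by apply: eq_bigr => y _; rewrite -EFinM mulrCA.
under eq_integral do rewrite E.
have iy y : Q.-integrable setT (fun t => (w t * \1_(h @^-1` [set y]) t)%:E).
  apply: (@integrableMl _ _ _ _ _ _ (EFin \o w) (\1_(h @^-1` [set y]))) => //.
    by apply: measurable_indic; exact: GS.
  apply: (@bounded_forall _ _ 1) => t.
  by rewrite indicE; case: (_ \in _); rewrite ?normr1// normr0.
rewrite integral_sum//=; last first.
  by move=> y; apply: integrableZl.
rewrite big1// => y _; rewrite integralZl//=.
rewrite (_ : integral _ _ _ = 0)%E ?mule0//.
rewrite -[RHS](w0 _ (mh y)) [RHS]integral_mkcond; apply: eq_integral => t _.
rewrite patchE indicE; case: ifPn => ht; first by rewrite mulr1.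
by rewrite mulr0.
Qed.

(** If [w] has zero conditional expectation given [G] then it is orthogonal to
every bounded [G]-measurable function. *)
Lemma condexp0_mul G (w Z : S -> R) (K : R) :
  (<<s G >> `<=` measurable) ->
  Q.-integrable setT (EFin \o w) ->
  (forall A, <<s G >> A -> (\int[Q]_(t in A) (w t)%:E = 0)%E) ->
  measurable_fun setT (Z : g_sigma_algebraType G -> R) ->
  (forall t, `|Z t| <= K) ->
  (\int[Q]_t (w t * Z t)%:E = 0)%E.
Proof.
move=> GS iw w0 mZ ZK.
have K0 : 0 <= K by apply: le_trans (ZK point).
have mw : measurable_fun setT w by apply/measurable_EFinP; case/integrableP: iw.
(* Shifting by [K] makes [Z] nonnegative, so that it is an increasing limit of
   simple functions. *)
pose Z' t : R := Z t + K.
have mZ' : measurable_fun setT (Z' : g_sigma_algebraType G -> R).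
  exact: measurable_funD.
have Z'0 t : 0 <= Z' t.
  by have := ZK t; rewrite /Z' ler_norml => /andP[]; lra.
have Z'K t : Z' t <= 2 * K.
  by have := ZK t; rewrite /Z' ler_norml => /andP[]; lra.
have mZE : measurable_fun setT (EFin \o Z' : g_sigma_algebraType G -> \bar R).
  exact/measurable_EFinP.
pose h := nnsfun_approx measurableT mZE.
have hZ t : EFin \o h ^~ t @ \oo --> (Z' t)%:E.
  by apply: (@cvg_nnsfun_approx _ _ _ _ measurableT _ mZE) => // x _; rewrite lee_fin.
have hle k t : h k t <= Z' t.
  rewrite -lee_fin /h nnsfun_approxE.
  by apply: (@le_approx _ _ _ setT (EFin \o Z')) => // x _; rewrite lee_fin.
have h0 k t : 0 <= h k t by [].
have iwK : Q.-integrable setT (fun t => ((2 * K)%:E * `|(w t)%:E|)%E).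
  by apply: integrableZl => //; exact: integrable_abse.
have mh k : measurable_fun setT (h k : S -> R).
  by apply: measurable_fun_sub GS _; exact: measurable_funP.
have wh0 : (fun k => \int[Q]_t (w t * h k t)%:E)%E = cst 0%E.
  by apply/funext => k; exact: nnsfun_mul0.
have Z'w : (\int[Q]_t (w t * Z' t)%:E = 0)%E.
  have [_ _] : [/\ Q.-integrable setT (fun t => (w t * Z' t)%:E),
      (fun k => \int[Q]_t `|(w t * h k t)%:E - (w t * Z' t)%:E|)%E @ \oo --> 0%E &
      (fun k => \int[Q]_t (w t * h k t)%:E)%E @ \oo --> (\int[Q]_t (w t * Z' t)%:E)%E].
    apply: (@dominated_convergence _ _ _ Q setT measurableT _ _
      (fun t => ((2 * K)%:E * `|(w t)%:E|)%E)) => //.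
    - by move=> k; apply/measurable_EFinP; exact: measurable_funM.
    - apply/measurable_EFinP; apply: measurable_funM => //.
      exact: measurable_fun_sub GS _.
    - apply: aeW => t _ /=; rewrite EFinM.
      under eq_fun do rewrite EFinM.
      by apply: cvgeZl => //; exact: hZ.
    - apply: aeW => t k _ /=; rewrite -EFinM lee_fin normrM mulrC ler_wpM2r//.
      by rewrite ger0_norm// (le_trans (hle _ _)).
  by rewrite wh0 => /(cvg_unique (@ereal_hausdorff R) (cvg_cst _)).
rewrite -[RHS]Z'w.
under [RHS]eq_integral do rewrite /Z' mulrDr EFinD [(w _ * K)%:E]EFinM muleC.
have iwZ : Q.-integrable setT (fun t => (w t * Z t)%:E).
  apply: (@integrableMl _ _ _ _ _ _ (EFin \o w) Z) => //.
    exact: measurable_fun_sub GS _.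
  exact: bounded_forall ZK.
rewrite integralD//=; last exact: integrableZl.
rewrite integralZl//= w0 ?mule0 ?adde0//.
exact: (@measurableT _ (g_sigma_algebraType G)).
Qed.
End Condexp.

(** * A maximal inequality *)

Section Stopped.
Context {R : realType} {dS : measure_display} {S : measurableType dS}.
Variable Q : probability S R.
Variables (G : nat -> set_system S) (w c : nat -> S -> R) (gamma : nat -> R).
Variable C : R.
Hypothesis GS : forall k, <<s G k >> `<=` measurable.
Hypothesis Ginc : forall k, <<s G k >> `<=` <<s G k.+1 >>.
Hypothesis mw :
  forall k, measurable_fun setT (w k : g_sigma_algebraType (G k.+1) -> R).
Hypothesis iw : forall k, Q.-integrable setT (EFin \o w k).
Hypothesis w0 :
  forall k A, <<s G k >> A -> (\int[Q]_(t in A) (w k t)%:E = 0)%E.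
Hypothesis iw2 : forall k, Q.-integrable setT (fun t => (w k t ^+ 2)%:E).
Hypothesis w2 : forall k, (\int[Q]_t (w k t ^+ 2)%:E <= C%:E)%E.
Hypothesis mc :
  forall k, measurable_fun setT (c k : g_sigma_algebraType (G k) -> R).
Hypothesis c1 : forall k t, `|c k t| <= 1.
Variable eps : R.
Hypothesis eps0 : 0 < eps.

(** The martingale transform of [w] by [gamma * c], stopped when its absolute
value reaches [eps]. *)
Fixpoint stopped k (t : S) : R :=
  if k is j.+1 then
    stopped j t +
      gamma j * (if `|stopped j t| < eps then c j t else 0) * w j t
  else 0.

Let b k t := if `|stopped k t| < eps then c k t else 0.

Let C0 : 0 <= C.
Proof.
by rewrite -lee_fin; apply: le_trans (w2 0); apply: integral_ge0 => t _;
  rewrite lee_fin sqr_ge0.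
Qed.

Let b1 k t : `|b k t| <= 1.
Proof. by rewrite /b; case: ifP => // _; rewrite normr0. Qed.

Let mb_of k :
  measurable_fun setT (stopped k : g_sigma_algebraType (G k) -> R) ->
  measurable_fun setT (b k : g_sigma_algebraType (G k) -> R).
Proof.
move=> mM; apply: measurable_fun_ifT => //.
apply: measurable_fun_ltr => //.
exact: measurableT_comp.
Qed.

Let mS k (f : S -> R) : measurable_fun setT (f : g_sigma_algebraType (G k) -> R) ->
  measurable_fun setT f.
Proof. exact: measurable_fun_sub. Qed.

Let measurable_stopped k :
  measurable_fun setT (stopped k : g_sigma_algebraType (G k) -> R).
Proof.
elim: k => [|k IH]; first exact: measurable_cst.
have up (f : S -> R) : measurable_fun setT (f : g_sigma_algebraType (G k) -> R) ->
    measurable_fun setT (f : g_sigma_algebraType (G k.+1) -> R).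
  by move=> mf _ B mB; apply: Ginc; exact: mf.
rewrite /=; apply: measurable_funD; first exact: up.
apply: measurable_funM => //; apply: measurable_funM => //.
exact: (up _ (mb_of IH)).
Qed.

Let mb k : measurable_fun setT (b k : g_sigma_algebraType (G k) -> R).
Proof. exact: (mb_of (@measurable_stopped k)). Qed.

Let stopped_moment k :
  Q.-integrable setT (fun t => (stopped k t ^+ 2)%:E) /\
  (\int[Q]_t (stopped k t ^+ 2)%:E <=
    (C * series (fun j => gamma j ^+ 2) k)%:E)%E.
Proof.
elim: k => [|k [iM IH]].
  have -> : (fun t => (stopped 0 t ^+ 2)%:E) = cst 0%E :> (S -> \bar R).
    by apply/funext => t /=; rewrite expr0n.
  split; first exact: integrable0.
  by rewrite integral_cst// mul0e series0 mulr0.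
(* Thanks to stopping, the factor [Z] of [w k] in the cross term is bounded. *)
pose Z t := stopped k t * b k t.
have ZK t : `|Z t| <= eps.
  rewrite /Z /b; case: ifPn => h; last by rewrite mulr0 normr0 ltW.
  by rewrite normrM -[leRHS]mulr1 ler_pM// ltW.
have mZ : measurable_fun setT (Z : g_sigma_algebraType (G k) -> R).
  by apply: measurable_funM; [exact: measurable_stopped|exact: mb].
have E t : (stopped k.+1 t ^+ 2)%:E = ((stopped k t ^+ 2)%:E +
    ((2 * gamma k)%:E * (w k t * Z t)%:E +
    (gamma k ^+ 2)%:E * (b k t ^+ 2 * w k t ^+ 2)%:E))%E.
  by rewrite -!EFinM -!EFinD /Z /=; congr EFin; rewrite -/(b k t); ring.
have iwZ : Q.-integrable setT (fun t => (w k t * Z t)%:E).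
  apply: (@integrableMl _ _ _ _ _ _ (EFin \o w k) Z) => //; first exact: (@mS k _ mZ).
  exact: bounded_forall ZK.
have ibw : Q.-integrable setT (fun t => (b k t ^+ 2 * w k t ^+ 2)%:E).
  apply: (@integrableMr _ _ _ _ _ measurableT (fun t => b k t ^+ 2)
    (fun t => (w k t ^+ 2)%:E)) => //.
    by apply: measurable_funX; exact: (@mS k _ (@mb k)).
  apply: (@bounded_forall _ _ _ 1) => t.
  by rewrite normrX exprn_ile1.
have i12 : Q.-integrable setT (fun t => ((2 * gamma k)%:E * (w k t * Z t)%:E +
    (gamma k ^+ 2)%:E * (b k t ^+ 2 * w k t ^+ 2)%:E)%E).
  by apply: integrableD => //; exact: integrableZl.
split.
  rewrite (_ : (fun t => _) = (fun t => ((stopped k t ^+ 2)%:E +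
    ((2 * gamma k)%:E * (w k t * Z t)%:E +
    (gamma k ^+ 2)%:E * (b k t ^+ 2 * w k t ^+ 2)%:E))%E)); last exact/funext.
  exact: integrableD.
under eq_integral do rewrite E.
rewrite integralD// integralD//; [|exact: integrableZl..].
rewrite !integralZl// (condexp0_mul (@GS k) (iw k) (@w0 k) mZ ZK) mule0 add0e.
rewrite seriesSrE mulrDr EFinD leeD// [C * _]mulrC [in leRHS]EFinM.
rewrite lee_wpmul2l ?lee_fin ?sqr_ge0//.
apply: le_trans (w2 k); apply: ge0_le_integral => //.
- by move=> t _; rewrite lee_fin mulr_ge0// sqr_ge0.
- by case/integrableP: ibw.
- by case/integrableP: (@iw2 k).
- move=> t _; rewrite lee_fin ler_piMl ?sqr_ge0//.
  by rewrite -real_normK ?num_real// exprn_ile1.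
Qed.

Let stop_event k : set S := [set t | eps <= `|stopped k t|].

Let measurable_stop_event k : measurable (stop_event k).
Proof.
rewrite /stop_event -[X in measurable X]setTI.
have mM : measurable_fun setT (stopped k) := @mS k _ (@measurable_stopped k).
have mN : measurable_fun setT (fun t => `|stopped k t|) by exact: measurableT_comp.
rewrite (_ : [set t | _] = (fun t => `|stopped k t|) @^-1` `[eps, +oo[).
  by apply: mN.
by apply/seteqP; split=> t /=; rewrite in_itv/= andbT.
Qed.

Let stop_event_le k :
  (Q (stop_event k) <= (C * series (fun j => gamma j ^+ 2) k / eps ^+ 2)%:E)%E.
Proof.
have [iM hM] := stopped_moment k.
rewrite -[stop_event k]setIT -integral_indic//.
rewrite -(@lee_pmul2l _ (eps ^+ 2)%:E) ?lte_fin ?exprn_gt0// -EFinM.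
rewrite mulrC divfK ?gt_eqF ?exprn_gt0//.
apply: le_trans hM; rewrite -integralZl//; last exact: integrable_indic.
apply: ge0_le_integral => //.
- by move=> t _; rewrite -EFinM lee_fin mulr_ge0// sqr_ge0.
- by apply: measurable_funeM; apply/measurable_EFinP; exact: measurable_indic.
- by case/integrableP: iM.
- move=> t _; rewrite -EFinM lee_fin indicE.
  have [/set_mem /= h|_] := boolP (t \in _); last by rewrite mulr0 sqr_ge0.
  by rewrite mulr1 -[leRHS]real_normK ?num_real// ler_pXn2r ?nnegrE ?(ltW eps0).
Qed.

(** A maximal inequality of Kolmogorov type, for infinitely many terms: if some
partial sum reaches [eps], so does the stopped martingale, which then keeps its
value; the second moment of the latter bounds the probability. *)
Lemma maximal_inequality G2 :
  (forall k, series (fun j => gamma j ^+ 2) k <= G2) ->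
  exists B, [/\ measurable B, (Q B <= (C * G2 / eps ^+ 2)%:E)%E &
    forall t k, eps <= `|series (fun j => gamma j * (c j t * w j t)) k| -> B t].
Proof.
move=> hG2; exists (\bigcup_k stop_event k); split.
- exact: bigcup_measurable.
- have nd : nondecreasing_seq stop_event.
    apply/nondecreasing_seqP => k; apply/subsetPset => t.
    by rewrite /stop_event /= => h; rewrite ltNge h /= mulr0 mul0r addr0.
  have h : (Q \o stop_event) @ \oo --> Q (\bigcup_k stop_event k).
    apply: nondecreasing_cvg_mu => //.
    by apply: bigcup_measurable => k _; exact: measurable_stop_event.
  rewrite -(cvg_lim _ h)//; apply: lime_le; first by apply/cvg_ex; eexists; exact: h.
  apply: nearW => k; apply: le_trans (stop_event_le k) _.
  by rewrite lee_fin ler_pM2r ?invr_gt0 ?exprn_gt0// ler_wpM2l.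
- move=> t k hk; apply: contrapT => nB.
  have small j : `|stopped j t| < eps.
    by rewrite ltNge; apply/negP => h; apply: nB; exists j.
  suff E : stopped k t = series (fun j => gamma j * (c j t * w j t)) k.
    by have := small k; rewrite E ltNge hk.
  elim: {hk} k => [|k IH]; first by rewrite series0.
  by rewrite seriesSrE /= small IH mulrA.
Qed.

End Stopped.

(** * Almost sure convergence of random series *)

Section MartingaleConvergence.
Context {R : realType} {dS : measure_display} {S : measurableType dS}.
Variable Q : probability S R.

(** Almost sure convergence of the martingale transform of square-integrable
martingale differences by bounded predictable coefficients, with
square-summable weights. *)
Lemma martingale_series_cvg (G : nat -> set_system S) (w c : nat -> S -> R)
    (gamma : nat -> R) (C : R) :
  (forall k, <<s G k >> `<=` measurable) ->
  (forall k, <<s G k >> `<=` <<s G k.+1 >>) ->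
  (forall k, measurable_fun setT (w k : g_sigma_algebraType (G k.+1) -> R)) ->
  (forall k, Q.-integrable setT (EFin \o w k)) ->
  (forall k A, <<s G k >> A -> (\int[Q]_(t in A) (w k t)%:E = 0)%E) ->
  (forall k, Q.-integrable setT (fun t => (w k t ^+ 2)%:E)) ->
  (forall k, (\int[Q]_t (w k t ^+ 2)%:E <= C%:E)%E) ->
  (forall k, measurable_fun setT (c k : g_sigma_algebraType (G k) -> R)) ->
  (forall k t, `|c k t| <= 1) ->
  cvgn (series (fun k => gamma k ^+ 2)) ->
  {ae Q, forall t, cvgn (series (fun k => gamma k * (c k t * w k t)))}.
Proof.
move=> GS Ginc mw iw w0 iw2 w2 mc c1 cg.
pose g2 := fun k => gamma k ^+ 2.
(* The maximal inequality is applied to the series started at [m]. *)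
pose tail m := limn (series g2) - series g2 m.
have tailP m k : series (fun j => gamma (j + m)%N ^+ 2) k <= tail m.
  rewrite /tail lerBrDl.
  have -> : series g2 m + series (fun j => gamma (j + m)%N ^+ 2) k =
      series g2 (k + m)%N.
    elim: k => [|k IH]; first by rewrite series0 add0n addr0.
    by rewrite addSn !seriesSrE addrA IH.
  apply: nondecreasing_cvgn_le => //; apply/nondecreasing_seqP => j.
  by rewrite seriesSrE lerDl sqr_ge0.
have tail0 : tail @ \oo --> 0.
  rewrite -(subrr (limn (series g2))); apply: cvgB => //; exact: cvg_cst.
pose s t k := series (fun k => gamma k * (c k t * w k t)) k.
pose e p : R := p.+1%:R^-1.
have e0 p : 0 < e p by rewrite invr_gt0 ltr0n.
have HB p m : exists B, [/\ measurable B,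
    (Q B <= (C * tail m / e p ^+ 2)%:E)%E &
    forall t k, e p <= `|s t (k + m)%N - s t m| -> B t].
  have [B [mB QB hB]] := @maximal_inequality R dS S Q (fun j => G (j + m)%N)
    (fun j => w (j + m)%N) (fun j => c (j + m)%N) (fun j => gamma (j + m)%N) C
    (fun j => GS _) (fun j => Ginc _) (fun j => mw _) (fun j => iw _)
    (fun j => @w0 _) (fun j => iw2 _) (fun j => w2 _) (fun j => mc _)
    (fun j => c1 _) (e p) (e0 p) (tail m) (tailP m).
  exists B; split=> // t k h; apply: (hB t k); apply: le_trans h _.
  rewrite (_ : s t (k + m)%N - s t m = series (fun j =>
      gamma (j + m)%N * (c (j + m)%N t * w (j + m)%N t)) k)//.
  rewrite /s; elim: k => [|k IH]; first by rewrite add0n series0 subrr.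
  by rewrite addSn !seriesSrE -IH addrAC.
pose B p m := projT1 (cid (HB p m)).
have BP p m : [/\ measurable (B p m), (Q (B p m) <= (C * tail m / e p ^+ 2)%:E)%E &
    forall t k, e p <= `|s t (k + m)%N - s t m| -> B p m t].
  by rewrite /B; case: cid.
have N0 p : Q (\bigcap_m B p m) = 0%E.
  apply/eqP; rewrite eq_le measure_ge0 andbT.
  have mN : measurable (\bigcap_m B p m).
    by apply: bigcap_measurable => //= m _; case: (BP p m).
  have h : (fun m => (C * tail m / e p ^+ 2)%:E) @ \oo --> 0%E.
    have h : (fun m => C * tail m / e p ^+ 2) @ \oo --> C * 0 / e p ^+ 2.
      by apply: cvgM; [apply: cvgM => //; exact: cvg_cst|exact: cvg_cst].
    rewrite mulr0 mul0r in h; apply: cvg_EFin; last exact: h.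
    by exists 0%N.
  rewrite -(cvg_lim _ h)//; apply: lime_ge; first by apply/cvg_ex; exists 0%E.
  apply: nearW => m; have [mB QB _] := BP p m; apply: le_trans QB.
  by apply: le_measure; rewrite ?inE// => t; exact.
have : {ae Q, forall t p, ~ (\bigcap_m B p m) t}.
  apply/ae_foralln => p; exists (\bigcap_m B p m); split; last 1 first.
  - by move=> t /= /contrapT.
  - by apply: bigcap_measurable => //= m _; case: (BP p m).
  - exact: N0.
apply: filterS => t ht; apply/cauchy_cvgP/cauchy_exP => eps eps0.
have [p _ hp] := @near_infty_natSinv_lt R (PosNum eps0).
have {}hp : e p < eps by exact: (hp p (leqnn p)).
have [m hm] : exists m, ~ B p m t.
  by apply/existsNP => h; apply: (ht p) => m _; exact: h.
exists (s t m); exists m => // k /= mk; rewrite -ball_normE /= distrC.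
rewrite ltNge; apply/negP => h; apply: hm.
have [_ _ /(_ t (k - m)%N)] := BP p m; apply; rewrite subnK//.
exact: le_trans (ltW hp) h.
Qed.

(** Nonnegative variables with bounded expectations and summable weights have
an almost surely convergent weighted sum. *)
Lemma ae_cvg_weighted_series (f : nat -> S -> R) (gamma : nat -> R) (C : R) :
  (forall k t, 0 <= f k t) -> (forall k, 0 <= gamma k) ->
  (forall k, Q.-integrable setT (EFin \o f k)) ->
  (forall k, (\int[Q]_t (f k t)%:E <= C%:E)%E) ->
  cvgn (series gamma) ->
  {ae Q, forall t, cvgn (series (fun k => gamma k * f k t))}.
Proof.
move=> f0 g0 fi fC cg.
pose h k t := (gamma k * f k t)%:E.
have mh k : measurable_fun setT (h k).
  apply/measurable_EFinP; apply: measurable_funM => //.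
  by apply/measurable_EFinP; case/integrableP: (fi k).
have h0 k t : (0 <= h k t)%E by rewrite lee_fin mulr_ge0.
have C0 : 0 <= C.
  by rewrite -lee_fin; apply: le_trans (fC 0%N); apply: integral_ge0 => t _;
    rewrite lee_fin.
have [Bg Bg0 hBg] := cvgn_bound cg.
have hI : (\int[Q]_t (\sum_(k <oo) h k t) <= (C * Bg)%:E)%E.
  rewrite integral_nneseries//; apply: lime_le.
    by apply: is_cvg_nneseries => k _ _; apply: integral_ge0 => t _.
  apply: nearW => k /=.
  apply: (@le_trans _ _ (\sum_(0 <= j < k) (gamma j * C)%:E)%E).
    apply: lee_sum => j _.
    have -> : (\int[Q]_t h j t = (gamma j)%:E * \int[Q]_t (f j t)%:E)%E.
      by rewrite -(integralZl measurableT (fi j)).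
    by rewrite EFinM lee_wpmul2l ?lee_fin.
  rewrite sumEFin lee_fin -mulr_suml mulrC ler_wpM2l//.
  exact: ler_normlW (hBg k).
have iS : Q.-integrable setT (fun t => (\sum_(k <oo) h k t)%E).
  apply/integrableP; split; first exact: ge0_emeasurable_sum.
  rewrite (eq_integral (fun t => \sum_(k <oo) h k t)%E).
    by apply: le_lt_trans hI _; rewrite ltry.
  by move=> t _; rewrite gee0_abs// nneseries_ge0.
have := integrable_ae measurableT iS; apply: filterS => t /(_ I) fin.
apply: (@nondecreasing_bounded_cvgn _ _ (fine (\sum_(k <oo) h k t)%E)) => k.
  by rewrite seriesSrE lerDl mulr_ge0.
rewrite -lee_fin fineK; last exact: fin.
rewrite /series /= -sumEFin; apply: nneseries_lim_ge => j _ _; exact: h0.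
Qed.

End MartingaleConvergence.

(** * Borel measurability of vector-valued functions *)

Section BorelVectors.
Context {R : realType} {d : measure_display} {T : measurableType d}.

Lemma open_borel_rV n (U : set 'rV[R]_n) : open U ->
  measurable (U : set (borel_rV R n)).
Proof. by move=> oU; exact: sub_sigma_algebra. Qed.

Lemma closed_borel_rV n (U : set 'rV[R]_n) : closed U ->
  measurable (U : set (borel_rV R n)).
Proof.
move=> cU; rewrite -[U]setCK; apply: measurableC; apply: open_borel_rV.
exact: closed_openC.
Qed.

Lemma measurable_fun_borel_rV n (f : T -> borel_rV R n) :
  (forall U : set 'rV[R]_n, open U -> measurable (f @^-1` U)) ->
  measurable_fun setT f.
Proof.
move=> hf.
apply: (@measurability _ _ T (borel_rV R n) setT f (@open 'rV[R]_n)) => // _ [U oU <-].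
by rewrite setTI; exact: hf.
Qed.

Lemma measurable_continuous_borel_rV n (f : T -> borel_rV R n)
    (phi : 'rV[R]_n -> R) :
  continuous phi -> measurable_fun setT f ->
  measurable_fun setT (fun t => phi (f t) : R).
Proof.
move=> cphi mf.
apply: (measurability _ (RGenOpens.measurableE R)) => _ [U [a [b ->]] <-].
rewrite setTI; set U' := `]a, b[%classic.
have oU : open U' by exact: interval_open.
have oV : open [set v : 'rV[R]_n | U' (phi v)].
  by move/continuousP : cphi => /(_ U' oU).
rewrite -[X in measurable X]setTI.
by apply: (mf measurableT _ (open_borel_rV oV)).
Qed.

Lemma measurable_coord n (f : T -> borel_rV R n) i :
  measurable_fun setT f -> measurable_fun setT (fun t => f t 0 i : R).
Proof.
apply: (measurable_continuous_borel_rV (phi := fun v : 'rV[R]_n => v 0 i)).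
exact: coord_continuous.
Qed.

(** Rational boxes form a countable base of the topology, so that coordinatewise
measurability is Borel measurability. *)
Lemma measurable_rV n (f : T -> borel_rV R n) :
  (forall i, measurable_fun setT (fun t => f t 0 i : R)) ->
  measurable_fun setT f.
Proof.
move=> mf; apply: measurable_fun_borel_rV => U oU.
pose bal (q : 'rV[rat]_n * nat) : set 'rV[R]_n :=
  [set v | `|map_mx ratr q.1 - v| < q.2.+1%:R^-1].
have mbal q : measurable (f @^-1` (bal q)).
  have -> : f @^-1` bal q = \bigcap_(i in [set: 'I_n])
      [set t | `|(map_mx ratr q.1 : 'rV[R]_n) 0 i - f t 0 i| < q.2.+1%:R^-1].
    apply/seteqP; split=> t /=.
      move=> h i _; apply: le_lt_trans h.
      by have := ler_coord_norm (map_mx ratr q.1 - f t) i; rewrite !mxE.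
    move=> h; apply: norm_lt_coord => // i.
    by rewrite !mxE; have := h i I; rewrite /= mxE.
  apply: fin_bigcap_measurable => // i _.
  have mg : measurable_fun setT
      (fun t => `|(map_mx ratr q.1 : 'rV[R]_n) 0 i - f t 0 i|).
    apply: measurableT_comp => //; apply: measurable_funB => //.
  rewrite -[X in measurable X]setTI.
  rewrite (_ : [set t | _] = (fun t => `|(map_mx ratr q.1 : 'rV[R]_n) 0 i - f t 0 i|)
      @^-1` `]-oo, q.2.+1%:R^-1[); first by apply: mg.
  by apply/seteqP; split=> t /=; rewrite in_itv.
pose P q : set T := if `[< bal q `<=` U >] then f @^-1` (bal q) else set0.
have -> : f @^-1` U = \bigcup_q P q.
  apply/seteqP; split=> [t /= Ut|t [q _]]; last first.
    by rewrite /P; case: asboolP => // h; exact: h.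
  have /nbhs_ballP[e /= e0 he] : nbhs (f t : 'rV[R]_n) U by exact: open_nbhs_nbhs.
  have e20 : 0 < e / 2 by rewrite divr_gt0.
  have [k _ /(_ k (leqnn k)) /= hk] := @near_infty_natSinv_lt R (PosNum e20).
  have k0 : 0 < k.+1%:R^-1 :> R by rewrite invr_gt0 ltr0n.
  have /choice[q hq] : forall i, exists q : rat, `|ratr q - f t 0 i| < k.+1%:R^-1.
    move=> i; have /rat_in_itvoo[q] : f t 0 i < f t 0 i + k.+1%:R^-1 by rewrite ltrDl.
    rewrite in_itv/= => /andP[h1 h2]; exists q.
    by rewrite gtr0_norm ?subr_gt0// ltrBlDl.
  pose z : 'rV[rat]_n * nat := (\row_i q i, k).
  exists z => //; rewrite /P asboolT.
    by apply: norm_lt_coord => // i; rewrite !mxE.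
  move=> v hv; apply: he; rewrite -ball_normE /=.
  rewrite -[f t](subrK (map_mx ratr z.1)) -addrA (le_lt_trans (ler_normD _ _))//.
  rewrite [e]splitr; apply: ltrD; apply: lt_trans hk; last exact: hv.
  by apply: norm_lt_coord => // i; rewrite !mxE distrC.
apply: countable_bigcupT_measurable => [|q]; first exact: countableP.
by rewrite /P; case: ifP.
Qed.

(** A function that is Lipschitz continuous with respect to a Borel measurable
function is measurable: preimages of open sets under the former are preimages
of open sets under the latter. *)
Lemma measurable_lipschitz n m (p : T -> borel_rV R n) (f : T -> borel_rV R m) K :
  measurable_fun setT p ->
  (forall t u, `|(f t : 'rV[R]_m) - f u| <= K * `|(p t : 'rV[R]_n) - p u|) ->
  measurable_fun setT f.
Proof.
move=> mp hf; apply: measurable_fun_borel_rV => U oU.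
pose I := [set i : T * R | 0 < i.2 /\ ball (f i.1 : 'rV[R]_m) i.2 `<=` U].
pose O : set 'rV[R]_n := \bigcup_(i in I) ball (p i.1 : 'rV[R]_n) (i.2 / (`|K| + 1)).
have K0 : 0 < `|K| + 1 by rewrite ltr_wpDl.
have oO : open O.
  by apply: bigcup_open => i [i0 _]; apply: ball_open; rewrite divr_gt0.
rewrite (_ : f @^-1` U = p @^-1` O).
  by rewrite -[X in measurable X]setTI; apply: mp => //; exact: open_borel_rV.
apply/seteqP; split=> t /=.
  move=> Ut; have /nbhs_ballP[e /= e0 he] : nbhs (f t : 'rV[R]_m) U.
    exact: open_nbhs_nbhs.
  by exists (t, e) => //=; apply: ballxx; rewrite divr_gt0.
case=> -[u e] [/= e0 he]; rewrite -ball_normE /= => hpt; apply: he.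
rewrite -ball_normE /=; apply: le_lt_trans (hf _ _) _.
rewrite ltr_pdivlMr// in hpt; apply: le_lt_trans hpt.
rewrite mulrC ler_wpM2l// (le_trans (ler_norm K))// lerDl//.
Qed.

(** The sampled map is only jointly measurable on [X], where [y] takes its
values. *)
Lemma measurable_random_map n m (X : set 'rV[R]_n)
    (F : 'rV[R]_n -> 'rV[R]_m -> 'rV[R]_n)
    (y : T -> borel_rV R n) (z : T -> borel_rV R m) :
  closed X ->
  measurable_fun (X `*` [set: borel_rV R m] : set (borel_rV R n * borel_rV R m))
    (fun p => F p.1 p.2 : borel_rV R n) ->
  (forall t, X (y t)) -> measurable_fun setT y -> measurable_fun setT z ->
  measurable_fun setT (fun t => F (y t) (z t) : borel_rV R n).
Proof.
move=> cX mF Xy my mz.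
pose g t : borel_rV R n * borel_rV R m := (y t, z t).
have mg : measurable_fun setT g by exact: measurable_fun_pair.
have mD : measurable (X `*` [set: borel_rV R m] : set (borel_rV R n * borel_rV R m)).
  by apply: measurableX => //; exact: closed_borel_rV.
by apply: (measurable_comp mD _ mF mg) => _ [t _ <-]; split => /=.
Qed.

End BorelVectors.

(** * Conditional expectations and histories *)

Section CondexpAs.
Context {R : realType} {dS : measure_display} {S : measurableType dS}.
Variable Q : probability S R.
Implicit Types (G : set_system S) (f : S -> R).

(** Consequences of hypotheses on conditional expectations, in terms of plain
integrals. *)
Lemma condexp_as0 G f : G `<=` measurable ->
  condexp_as Q G f (fun e => e = 0) ->
  Q.-integrable setT (EFin \o f) /\
  forall A, G A -> (\int[Q]_(t in A) (f t)%:E = 0)%E.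
Proof.
move=> GS [g [intf intg _ fg] g0]; split=> // A GA.
rewrite fg//; have mA := GS _ GA.
rewrite (ae_eq_integral (cst 0%E))//.
- by rewrite integral_cst// mul0e.
- by apply: measurable_funTS; case/integrableP: intg.
- by apply: filterS g0 => t /= -> _.
Qed.

Lemma condexp_as_le G f c : 0 <= c -> G setT ->
  condexp_as Q G f (fun e => e <= c) ->
  Q.-integrable setT (EFin \o f) /\ (\int[Q]_t (f t)%:E <= c%:E)%E.
Proof.
move=> c0 GT [g [intf intg _ fg] [N [mN QN gN]]]; split=> //.
rewrite fg// (negligible_integral mN)//.
have mD : measurable (setT `\` N) by apply: measurableD.
apply: (@le_trans _ _ (\int[Q]_(t in setT `\` N) c%:E)%E).
  apply: le_integral => //.
  - exact: integrableS intg.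
  - by apply: finite_measure_integrable_cst.
  - move=> t; rewrite inE => -[_ nN] /=; rewrite lee_fin.
    by apply: contrapT => h; apply: nN; exact: gN.
rewrite integral_cst// -[leRHS]mule1 lee_wpmul2l ?lee_fin//.
exact: probability_le1.
Qed.

End CondexpAs.

Section Histories.
Context {R : realType} {n : nat} {dO dS : measure_display}.
Context {Om : measurableType dO} {S : measurableType dS}.
Variables (x0 : S -> borel_rV R n) (om omh : nat -> S -> Om).
Let Fk := history x0 om omh.
Let Fkh := history_half x0 om omh.

Lemma sigma_historyE k : <<s Fk k >> = Fk k.
Proof. by apply: sigma_algebra_id; exact: smallest_sigma_algebra. Qed.

Lemma sigma_history_halfE k : <<s Fkh k >> = Fkh k.
Proof. by apply: sigma_algebra_id; exact: smallest_sigma_algebra. Qed.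

Lemma history_sub_half k : Fk k `<=` Fkh k.
Proof. by move=> A FA; apply: sub_sigma_algebra; left. Qed.

Lemma history_half_subS k : Fkh k `<=` Fk k.+1.
Proof.
apply: smallest_sub; first exact: smallest_sigma_algebra.
move=> A [|]; last first.
  by move=> hA; apply: sub_sigma_algebra; right; exists k => //=; left.
apply: sub_sigma_algebra2 => {}A [hA|[j /= jk hA]]; first by left.
by right; exists j => //=; exact: ltnW.
Qed.

Hypothesis mx0 : measurable_fun setT x0.
Hypothesis mom : forall k, measurable_fun setT (om k).
Hypothesis momh : forall k, measurable_fun setT (omh k).

Lemma history_measurable k : Fk k `<=` measurable.
Proof.
apply: smallest_sub; first exact: sigma_algebra_measurable.
by move=> A [[B mB <-]|[j _ [[B mB <-]|[B mB <-]]]];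
  [exact: mx0|exact: mom|exact: momh].
Qed.

Lemma history_half_measurable k : Fkh k `<=` measurable.
Proof. by move=> A /history_half_subS; exact: history_measurable. Qed.

Lemma measurable_start_history :
  measurable_fun setT (x0 : g_sigma_algebraType (Fk 0) -> borel_rV R n).
Proof.
by move=> _ B mB; apply: (@sub_sigma_algebra _ setT (Fk 0)); apply: sub_sigma_algebra;
  left; exists B.
Qed.

Lemma measurable_draw_half k :
  measurable_fun setT (om k : g_sigma_algebraType (Fkh k) -> Om).
Proof.
by move=> _ B mB; apply: (@sub_sigma_algebra _ setT (Fkh k));
  apply: sub_sigma_algebra; right; exists B.
Qed.

Lemma measurable_draw_next k :
  measurable_fun setT (omh k : g_sigma_algebraType (Fk k.+1) -> Om).
Proof.
by move=> _ B mB; apply: (@sub_sigma_algebra _ setT (Fk k.+1));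
  apply: sub_sigma_algebra; right; exists k => //=; right; exists B.
Qed.

End Histories.

(** Measurability for a sigma-algebra implies it for any larger one. *)
Lemma measurable_fun_widen (T : pointedType) dU (U : measurableType dU)
    (G G' : set_system T) (f : T -> U) : <<s G >> `<=` <<s G' >> ->
  measurable_fun setT (f : g_sigma_algebraType G -> U) ->
  measurable_fun setT (f : g_sigma_algebraType G' -> U).
Proof. by move=> GG' mf _ B mB; apply: GG'; exact: mf. Qed.

(** * Measurability of the iterates *)

(** Lipschitz continuity from the given norm to its dual norm implies Lipschitz
continuity for the sup norm. *)
Lemma dual_lipschitz_sup (R : realType) n (nrm : 'rV[R]_n -> R) (X : set 'rV[R]_n)
    (H : 'rV[R]_n -> 'rV[R]_n) (L : R) : is_norm nrm -> 0 <= L ->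
  (forall x y, X x -> X y -> dual_norm nrm (H x - H y) <= L * nrm (x - y)) ->
  exists K, forall x y, X x -> X y -> `|H x - H y| <= K * `|x - y|.
Proof.
move=> nrmP L0 hL; have [c c0 hc] := sup_le_dual nrmP.
have [C C0 hC] := nrm_le_sup nrmP.
exists (c * (L * C)) => x y Xx Xy; rewrite -!mulrA (le_trans (hc _))// ler_pM2l//.
by rewrite (le_trans (hL _ _ Xx Xy))// ler_wpM2l.
Qed.

Section MeasurableProx.
Context {R : realType} {n : nat} {d : measure_display} {T : measurableType d}.
Variables (X : set 'rV[R]_n) (nrm s : 'rV[R]_n -> R) (theta LV : R).
Hypotheses (cX : convex_set (M := 'rV[R]_n) X) (nrmP : is_norm nrm).
Hypothesis sP : prox_function nrm X s theta LV.

Lemma measurable_lipschitz_on (H : 'rV[R]_n -> 'rV[R]_n) K (y : T -> borel_rV R n) :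
  (forall u v, X u -> X v -> `|H u - H v| <= K * `|u - v|) ->
  (forall t, X (y t)) -> measurable_fun setT y ->
  measurable_fun setT (fun t => H (y t) : borel_rV R n).
Proof. by move=> HK Xy my; apply: (measurable_lipschitz my) => t u; exact: HK. Qed.

Lemma measurable_prox (y r z : T -> borel_rV R n) :
  (forall t, X (y t)) -> (forall t, prox X s (y t) (r t) (z t)) ->
  measurable_fun setT y -> measurable_fun setT r -> measurable_fun setT z.
Proof.
move=> Xy zP my mr.
have [c c0 hc] := sup_le_nrm nrmP.
have [C C0 hC] := dual_le_sup nrmP.
have [K hK] : exists K, forall u v, X u -> X v ->
    `|grad s u - grad s v| <= K * `|u - v|.
  by case: sP => _ _ _ [LV0 hLV] _; exact: dual_lipschitz_sup nrmP (ltW LV0) hLV.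
pose p t : borel_rV R n := (r t : 'rV[R]_n) - grad s (y t).
have mgy : measurable_fun setT (fun t => grad s (y t) : borel_rV R n).
  exact: measurable_lipschitz_on hK Xy my.
have mp : measurable_fun setT p.
  apply: measurable_rV => i; rewrite (_ : (fun t => p t 0 i) =
    (fun t => r t 0 i - grad s (y t) 0 i)); last by apply/funext => t; rewrite !mxE.
  apply: measurable_funB; first exact: measurable_coord.
  exact: (measurable_coord (f := fun t => grad s (y t))).
apply: (measurable_lipschitz (K := c * C) mp) => t u.
rewrite -mulrA (le_trans (hc _))// ler_pM2l// (le_trans _ (hC _))//.
exact: (prox_lipschitz nrmP cX sP (Xy t) (Xy u) (zP t) (zP u)).
Qed.

End MeasurableProx.

Section Iterates.
Context {R : realType} {n m : nat}.
Variables (X : set 'rV[R]_n) (nrm s : 'rV[R]_n -> R) (theta LV : R).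
Hypotheses (clX : closed X) (cX : convex_set (M := 'rV[R]_n) X).
Hypotheses (nrmP : is_norm nrm) (sP : prox_function nrm X s theta LV).
Context (dO : measure_display) (Om : measurableType dO) (P : probability Om R).
Variables (xi : Om -> borel_rV R m) (F : 'rV[R]_n -> 'rV[R]_m -> 'rV[R]_n).
Hypotheses (xi_meas : measurable_fun [set: Om] xi) (F_random : random_map P xi X F).
Let H := mean_map P xi F.
Variable K : R.
Hypothesis HK : forall u v, X u -> X v -> `|H u - H v| <= K * `|u - v|.
Context (gamma : nat -> R) (dS : measure_display) (S : measurableType dS).
Variables (om omh : nat -> S -> Om) (x xh : nat -> S -> borel_rV R n).
Hypothesis xP : mpsa X s xi F gamma om omh x xh.
Let Fk := history (x 0%N) om omh.
Let Fkh := history_half (x 0%N) om omh.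

Lemma mpsa_mem k t : X (x k t).
Proof. by case: xP => x0X xkP; case: k => [//|k]; case: (xkP k t) => _ []. Qed.

Lemma mpsa_half_mem k t : X (xh k t).
Proof. by case: xP => _ /(_ k t) [[]]. Qed.

Let sub1 k : <<s Fk k >> `<=` <<s Fkh k >>.
Proof. rewrite sigma_historyE sigma_history_halfE; exact: history_sub_half. Qed.

Let sub2 k : <<s Fkh k >> `<=` <<s Fk k.+1 >>.
Proof. rewrite sigma_historyE sigma_history_halfE; exact: history_half_subS. Qed.

Let measurable_sample d (T : measurableType d) (y : T -> borel_rV R n) (o : T -> Om) :
  (forall t, X (y t)) -> measurable_fun setT y -> measurable_fun setT o ->
  measurable_fun setT (fun t => F (y t) (xi (o t)) : borel_rV R n).
Proof.
move=> Xy my mo; apply: (measurable_random_map clX _ Xy my); first by case: F_random.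
exact: measurableT_comp.
Qed.

Let measurable_scale d (T : measurableType d) (a : R) (f : T -> borel_rV R n) :
  measurable_fun setT f ->
  measurable_fun setT (fun t => a *: (f t : 'rV[R]_n) : borel_rV R n).
Proof.
move=> mf; apply: measurable_rV => i.
rewrite (_ : (fun t => _) = (fun t => a * f t 0 i)).
  by apply: measurable_funM => //; exact: measurable_coord.
by apply/funext => t; rewrite mxE.
Qed.

Let half_of k :
  measurable_fun setT (x k : g_sigma_algebraType (Fk k) -> borel_rV R n) ->
  measurable_fun setT (xh k : g_sigma_algebraType (Fkh k) -> borel_rV R n).
Proof.
move=> mx; have mx' := measurable_fun_widen (@sub1 k) mx.
apply: (measurable_prox (T := g_sigma_algebraType (Fkh k)) cX nrmP sP (y := x k)
  (r := fun t => gamma k *: F (x k t) (xi (om k t)))) => //.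
- by move=> t; exact: mpsa_mem.
- by move=> t; case: xP => _ /(_ k t) [].
- apply: measurable_scale; apply: measurable_sample => //.
    by move=> t; exact: mpsa_mem.
  exact: measurable_draw_half.
Qed.

Lemma measurable_iterate k :
  measurable_fun setT (x k : g_sigma_algebraType (Fk k) -> borel_rV R n).
Proof.
elim: k => [|k IH]; first exact: measurable_start_history.
have mxh := measurable_fun_widen (@sub2 k) (half_of IH).
have mx' := measurable_fun_widen (@sub2 k) (measurable_fun_widen (@sub1 k) IH).
apply: (measurable_prox (T := g_sigma_algebraType (Fk k.+1)) cX nrmP sP (y := x k)
  (r := fun t => gamma k *: F (xh k t) (xi (omh k t)))) => //.
- by move=> t; exact: mpsa_mem.
- by move=> t; case: xP => _ /(_ k t) [].
- apply: measurable_scale; apply: measurable_sample => //.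
    by move=> t; exact: mpsa_half_mem.
  exact: measurable_draw_next.
Qed.

Lemma measurable_half_iterate k :
  measurable_fun setT (xh k : g_sigma_algebraType (Fkh k) -> borel_rV R n).
Proof. exact: (half_of (@measurable_iterate k)). Qed.

(** The noise of the half-step [k] is measurable for the next half-history: the
martingale differences are adapted with this shift. *)
Lemma measurable_half_noise k i :
  measurable_fun setT
    ((fun t => noise P xi F (xh k) (omh k) t 0 i)
      : g_sigma_algebraType (Fkh k.+1) -> R).
Proof.
have mxh : measurable_fun setT (xh k : g_sigma_algebraType (Fkh k.+1) -> borel_rV R n).
  apply: (measurable_fun_widen (@sub1 k.+1)); apply: (measurable_fun_widen (@sub2 k)).
  exact: measurable_half_iterate.
have mo := measurable_fun_widen (@sub1 k.+1)
  (@measurable_draw_next _ _ _ _ _ _ (x 0%N) om omh k).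
have mF := measurable_sample (T := g_sigma_algebraType (Fkh k.+1))
  (mpsa_half_mem k) mxh mo.
have mH := measurable_lipschitz_on (T := g_sigma_algebraType (Fkh k.+1)) HK
  (mpsa_half_mem k) mxh.
have -> : (fun t => noise P xi F (xh k) (omh k) t 0 i) =
    (fun t => F (xh k t) (xi (omh k t)) 0 i - H (xh k t) 0 i) :> (S -> R).
  by apply/funext => t; rewrite !mxE.
apply: measurable_funB; first exact: (measurable_coord i mF).
exact: (measurable_coord i mH).
Qed.

End Iterates.

(** * Almost sure convergence of the scheme *)

Lemma measurable_inv_gt0 (R : realType) d (T : measurableType d) (f : T -> R) :
  (forall t, 0 < f t) -> measurable_fun setT f ->
  measurable_fun setT (fun t => (f t)^-1).
Proof.
move=> f0 mf; rewrite (_ : (fun t => _) = (fun t => f t `^ (-1))).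
  have mp := measurable_powR (-1 : R).
  exact: (measurableT_comp mp mf).
by apply/funext => t; rewrite powR_inv1// ltW.
Qed.

Lemma measurable_runmax_dist (R : realType) n dS (S : measurableType dS)
    (G : nat -> set_system S) (y : nat -> S -> borel_rV R n) (c : 'rV[R]_n) k :
  (forall k, <<s G k >> `<=` <<s G k.+1 >>) ->
  (forall k, measurable_fun setT (y k : g_sigma_algebraType (G k) -> borel_rV R n)) ->
  measurable_fun setT ((fun t => runmax (fun j => `|(y j t : 'rV[R]_n) - c|) k)
    : g_sigma_algebraType (G k) -> R).
Proof.
move=> Ginc my.
have md j : measurable_fun setT ((fun t => `|(y j t : 'rV[R]_n) - c|)
    : g_sigma_algebraType (G j) -> R).
  apply: (measurable_continuous_borel_rV (T := g_sigma_algebraType (G j))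
    (phi := fun v : 'rV[R]_n => `|v - c|)) (my j).
  apply: (lipschitz_continuous_rV (ltr01 : 0 < 1 :> R)) => u v.
  by rewrite mul1r (le_trans (ler_dist_dist _ _))// opprB addrA subrK.
elim: k => [|k IH]; first by apply: measurable_maxr => //; exact: md.
apply: measurable_maxr; last exact: md.
exact: measurable_fun_widen (Ginc k) IH.
Qed.

Theorem corollary1
  (R : realType) (n m : nat)
  (X : set 'rV[R]_n) (X_nonempty : X !=set0) (X_closed : closed X)
  (X_convex : convex_set (M := 'rV[R]_n) X)
  (nrm : 'rV[R]_n -> R) (nrm_norm : is_norm nrm)
  (dO : measure_display) (Om : measurableType dO) (P : probability Om R)
  (xi : Om -> borel_rV R m) (xi_meas : measurable_fun [set: Om] xi)
  (F : 'rV[R]_n -> 'rV[R]_m -> 'rV[R]_n) (F_random : random_map P xi X F)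
  (F_cont : {within X, continuous (mean_map P xi F)})
  (sol_nonempty : SVI X (mean_map P xi F) !=set0)
  (s : 'rV[R]_n -> R) (theta LV : R)
  (s_prox : prox_function nrm X s theta LV)
  (A6 : exists Ls Bs : R, [/\ 0 < Ls, 0 < Bs &
      forall x y, X x -> X y ->
        dual_norm nrm (mean_map P xi F x - mean_map P xi F y)
          <= Ls * nrm (x - y) /\
        dual_norm nrm (mean_map P xi F x) <= Bs / 2])
  (F_cases :
    [\/ acute_angle X (mean_map P xi F),
        strictly_pseudomonotone X (mean_map P xi F),
        strongly_pseudomonotone nrm X (mean_map P xi F)
      | pseudomonotone X (mean_map P xi F) /\
        expected_gradient P X (mean_map P xi F)]) :
  exists2 gamma_bar : R, 0 < gamma_bar &
  forall (gamma : nat -> R)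
    (dS : measure_display) (S : measurableType dS) (Q : probability S R)
    (om omh : nat -> S -> Om) (x xh : nat -> S -> 'rV[R]_n),
    (forall k, 0 < gamma k) ->
    gamma @ \oo --> 0 ->
    gamma 0%N <= gamma_bar ->
    (forall k, measurable_fun [set: S] (om k) /\
               measurable_fun [set: S] (omh k)) ->
    measurable_fun [set: S] (x 0%N : S -> borel_rV R n) ->
    mpsa X s xi F gamma om omh x xh ->
    let Fk := history (x 0%N) om omh in
    let Fkh := history_half (x 0%N) om omh in
    let w := fun k => noise P xi F (x k) (om k) in
    let wh := fun k => noise P xi F (xh k) (omh k) in
    (* A1 *)
    (forall k i,
      condexp_as Q (Fk k) (fun t => w k t 0 i) (fun e => e = 0) /\
      condexp_as Q (Fkh k) (fun t => wh k t 0 i) (fun e => e = 0)) ->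
    (* A2 *)
    (exists2 nu : R, 0 < nu & forall k,
      condexp_as Q (Fk k) (fun t => nrm (w k t) ^+ 2)
        (fun e => e <= nu ^+ 2) /\
      condexp_as Q (Fkh k) (fun t => nrm (wh k t) ^+ 2)
        (fun e => e <= nu ^+ 2)) ->
    (* A3 *)
    cvgn (series (fun k => gamma k ^+ 2)) ->
    (* A4 *)
    series gamma @ \oo --> +oo ->
    (* A7 *)
    (exists2 nus : R, 0 < nus & forall k,
      condexp_as Q (Fk k) (fun t => dual_norm nrm (w k t) ^+ 2)
        (fun e => e <= nus ^+ 2) /\
      condexp_as Q (Fkh k) (fun t => dual_norm nrm (wh k t) ^+ 2)
        (fun e => e <= nus ^+ 2)) ->
    {ae Q, forall t,
      bounded_fun (fun k => x k t) /\
      forall z, cluster ((fun k => x k t) @ \oo) z ->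
        SVI X (mean_map P xi F) z}.
Proof.
pose H := mean_map P xi F.
have [Ls [Bs [Ls0 Bs0 HA6]]] := A6.
have [K HK] : exists K, forall u v, X u -> X v -> `|H u - H v| <= K * `|u - v|.
  apply: (dual_lipschitz_sup nrm_norm (ltW Ls0)) => u v Xu Xv.
  by case: (HA6 u v Xu Xv).
have HB u : X u -> dual_norm nrm (H u) <= Bs / 2.
  by move=> Xu; case: (HA6 u u Xu Xu).
have aH : acute_angle X H.
  case: F_cases => [//|sm|sm|[pm [f hf]]].
  - exact: strictly_pseudomonotone_acute.
  - apply: strictly_pseudomonotone_acute.
    exact: strongly_pseudomonotone_strictly nrm_norm sm.
  - apply: (pseudomonotone_gradient_acute X_convex _ pm) => u Xu.
    by have [_ d g] := hf u Xu; split; [exact: d|exact: g].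
have [xs sxs] := sol_nonempty.
have [cd cd0 hcd] := sup_le_dual nrm_norm.
(* The one-step estimate holds for all positive steplengths, so that any
   positive threshold is suitable. *)
exists 1 => // gamma dS S Q om omh x xh gamma_gt0 _ _ mdraw mx0 xP Fk Fkh w wh.
move=> A1 _ A3 A4 [nus nus0 A7].
have mom k : measurable_fun setT (om k) by case: (mdraw k).
have momh k : measurable_fun setT (omh k) by case: (mdraw k).
have FkT k : Fk k setT by exact: (@measurableT _ (g_sigma_algebraType _)).
have FkhT k : Fkh k setT by exact: (@measurableT _ (g_sigma_algebraType _)).
have GS k : <<s Fkh k >> `<=` measurable.
  by rewrite sigma_history_halfE; exact: history_half_measurable.
have Ginc k : <<s Fkh k >> `<=` <<s Fkh k.+1 >>.
  rewrite !sigma_history_halfE => A /history_half_subS.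
  exact: history_sub_half.
have mxh k : measurable_fun setT (xh k : g_sigma_algebraType (Fkh k) -> borel_rV R n).
  exact: (measurable_half_iterate X_closed X_convex nrm_norm s_prox xi_meas
    F_random xP).
have mwh k i : measurable_fun setT
    ((fun t => wh k t 0 i) : g_sigma_algebraType (Fkh k.+1) -> R).
  exact: (measurable_half_noise X_closed X_convex nrm_norm s_prox xi_meas
    F_random HK xP).
have wh_int k i := condexp_as0 (history_half_measurable mx0 mom momh (k := k))
  (A1 k i).2.
have iwh k i : Q.-integrable setT (EFin \o (fun t => wh k t 0 i)).
  by case: (wh_int k i).
have wh0 k i A : <<s Fkh k >> A -> (\int[Q]_(t in A) (wh k t 0 i)%:E = 0)%E.
  by rewrite sigma_history_halfE; case: (wh_int k i) => _; apply.
have w7 k := condexp_as_le (sqr_ge0 nus) (FkT k) (A7 k).1.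
have wh7 k := condexp_as_le (sqr_ge0 nus) (FkhT k) (A7 k).2.
have wh_le k i t : wh k t 0 i ^+ 2 <= cd ^+ 2 * dual_norm nrm (wh k t) ^+ 2.
  rewrite -exprMn -real_normK ?num_real// ler_pXn2r ?nnegrE//.
    by rewrite (le_trans (ler_coord_norm _ _))// hcd.
  by rewrite mulr_ge0 ?dual_norm_ge0// ltW.
have iwh7 k : Q.-integrable setT
    (fun t => ((cd ^+ 2)%:E * (dual_norm nrm (wh k t) ^+ 2)%:E)%E).
  by apply: integrableZl => //; case: (wh7 k).
have iwh2 k i : Q.-integrable setT (fun t => (wh k t 0 i ^+ 2)%:E).
  apply: le_integrable (iwh7 k) => //.
    apply/measurable_EFinP; apply: measurable_funX.
    exact: measurable_fun_sub (GS k.+1) (mwh k i).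
  move=> t _; rewrite -EFinM !abse_EFin lee_fin !ger0_norm ?sqr_ge0//.
  by rewrite mulr_ge0 ?sqr_ge0.
have wh2 k i : (\int[Q]_t (wh k t 0 i ^+ 2)%:E <= (cd ^+ 2 * nus ^+ 2)%:E)%E.
  have [iw hw] := wh7 k.
  apply: (@le_trans _ _
    (\int[Q]_t ((cd ^+ 2)%:E * (dual_norm nrm (wh k t) ^+ 2)%:E))%E).
    by apply: le_integral => // t _; rewrite -EFinM lee_fin.
  by rewrite integralZl// [in leRHS]EFinM lee_wpmul2l ?lee_fin ?sqr_ge0.
(* With [rho] as denominator the coefficients of the noise are bounded by 1 and
   measurable for the half-history. *)
pose rho k t := runmax (fun j => `|xh j t - xs|) k.
have rho_gt0 k t : 0 < rho k t by exact: lt_le_trans ltr01 (runmax_ge1 _ _).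
have mrho k : measurable_fun setT (rho k : g_sigma_algebraType (Fkh k) -> R).
  exact: measurable_runmax_dist.
have noise1 : {ae Q, forall t i, cvgn (series (fun k => gamma k * wh k t 0 i))}.
  apply: filter_forall => i.
  have : {ae Q, forall t, cvgn (series (fun k => gamma k * (1 * wh k t 0 i)))}.
    apply: (@martingale_series_cvg R dS S Q Fkh (fun k t => wh k t 0 i)
      (fun _ _ => 1) gamma _ GS Ginc (@mwh ^~ i) (@iwh ^~ i) (fun k => @wh0 k i)
      (@iwh2 ^~ i) (@wh2 ^~ i)) => //.
    by move=> _ _; rewrite normr1.
  by apply: filterS => t; under eq_fun do rewrite mul1r.
have noise2 : {ae Q, forall t i, cvgn (series (fun k =>
    gamma k * ((xh k t - xs) 0 i / rho k t * wh k t 0 i)))}.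
  apply: filter_forall => i.
  apply: (@martingale_series_cvg R dS S Q Fkh (fun k t => wh k t 0 i)
    (fun k t => (xh k t - xs) 0 i / rho k t) gamma _ GS Ginc (@mwh ^~ i)
    (@iwh ^~ i) (fun k => @wh0 k i) (@iwh2 ^~ i) (@wh2 ^~ i)) => //.
  - move=> k; apply: measurable_funM.
      apply: (measurable_continuous_borel_rV (T := g_sigma_algebraType (Fkh k))
        (phi := fun v : 'rV[R]_n => (v - xs) 0 i)) (mxh k).
      apply: (lipschitz_continuous_rV (ltr01 : 0 < 1 :> R)) => u v.
      rewrite mul1r; apply: le_trans (ler_coord_norm (u - v) i).
      by rewrite !mxE opprB addrA subrK.
    exact: (measurable_inv_gt0 (T := g_sigma_algebraType (Fkh k)) (rho_gt0 k)
      (@mrho k)).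
  - move=> k t; rewrite normrM normfV (gtr0_norm (rho_gt0 k t)) ler_pdivrMr// mul1r.
    apply: le_trans (ler_coord_norm _ _) _.
    exact: (le_runmax (fun j => `|xh j t - xs|)).
have sum_w : {ae Q, forall t,
    cvgn (series (fun k => gamma k ^+ 2 * dual_norm nrm (w k t) ^+ 2))}.
  apply: (@ae_cvg_weighted_series _ _ _ Q (fun k t => dual_norm nrm (w k t) ^+ 2)
    (fun k => gamma k ^+ 2) (nus ^+ 2)) => // k.
  - by move=> t; exact: sqr_ge0.
  - exact: sqr_ge0.
  - by case: (w7 k).
  - by case: (w7 k).
have sum_wh : {ae Q, forall t,
    cvgn (series (fun k => gamma k ^+ 2 * dual_norm nrm (wh k t) ^+ 2))}.
  apply: (@ae_cvg_weighted_series _ _ _ Q (fun k t => dual_norm nrm (wh k t) ^+ 2)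
    (fun k => gamma k ^+ 2) (nus ^+ 2)) => // k.
  - by move=> t; exact: sqr_ge0.
  - exact: sqr_ge0.
  - by case: (wh7 k).
  - by case: (wh7 k).
apply: filterS3 noise1 noise2 (filterI sum_w sum_wh).
move=> t n1 n2 [sw swh].
have [x0X xkP] := xP.
have Nx k : H (x k t) + w k t = F (x k t) (xi (om k t)) by rewrite addrC subrK.
have Nxh k : H (xh k t) + wh k t = F (xh k t) (xi (omh k t)) by rewrite addrC subrK.
have [p sp xp] : exists2 p, SVI X H p & (fun k => x k t) @ \oo --> p.
  apply: (@path_convergence R n X nrm s theta LV H K Bs X_closed X_convex nrm_norm
    s_prox HK HB aH (fun k => x k t) (fun k => xh k t) (fun k => w k t)
    (fun k => wh k t) gamma xs) => //.
  - by move=> k; rewrite Nx; case: (xkP k t).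
  - by move=> k; rewrite Nxh; case: (xkP k t).
split.
  by apply: cvg_seq_bounded; apply/cvg_ex; exists p.
move=> z zc; suff -> : z = p by [].
apply/eqP; rewrite -subr_eq0 -normr_le0; apply/ler_addgt0Pr => e e0; rewrite add0r.
have e20 : 0 < e / 2 by rewrite divr_gt0.
have [N _ hN] := (cvgrPdist_lt _ _).1 xp _ e20.
have [k Nk zk] := cluster_seqP zc N e20.
rewrite -(subrKA (x k t)) (le_trans (ler_normD _ _))// [e]splitr lerD ?(ltW zk)//.
by rewrite distrC ltW// hN.
Qed.
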